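(* Let $\Gamma$ be a finitely generated, recursively presented, amenable group. Then $\Gamma$ has solvable Word Problem if and only if $\Gamma$ has solvable generic Equality Problem.
   Context: For a finite generating set $X$ of $\Gamma$, let $\mathsf X$ be a set with a bijection $\mathsf X\to X$, let $\mathbb F_{\mathsf X}$ be the free group on $\mathsf X$, and let $\pi_\Gamma\colon\mathbb F_{\mathsf X}\to\Gamma$ be the unique epimorphism extending this bijection. $\Gamma$ is recursively presented (recursively presentable) if there is a recursive set $R\subset\mathbb F_{\mathsf X}$ whose normal closure is $\ker\pi_\Gamma$. $\Gamma$ is amenable if for every integer $n\ge1$ there is a non-empty finite $\Omega\subset\Gamma$ with $|\Omega\setminus x\Omega|/|\Omega|\le n^{-1}$ for all $x\in X$. $\Gamma$ has solvable Word Problem if there exists an algorithm that, for every input $\omega\in\mathbb F_{\mathsf X}$, stops and establishes whether or not $\pi_\Gamma(\omega)=1_\Gamma$; equivalently, $\ker\pi_\Gamma\subset\mathbb F_{\mathsf X}$ is recursive (this does not depend on $X$). The Equality Problem (EP) is solvable on a subset $S\subset\mathbb F_{\mathsf X}$ if there exists an algorithm with input $(\omega_1,\omega_2)\in\mathbb F_{\mathsf X}\times\mathbb F_{\mathsf X}$ such that whenever $(\omega_1,\omega_2)\in S\times S$ the algorithm stops, establishing whether $\pi_\Gamma(\omega_1)=\pi_\Gamma(\omega_2)$ or not. Let $B_n$ be the ball of radius $n$ (word length with respect to $\mathsf X\cup\mathsf X^{-1}$) in $\mathbb F_{\mathsf X}$. A subset $S\subset\mathbb F_{\mathsf X}$ is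 generic if $\lim_{n\to\infty}|S\cap B_n|/|B_n|=1$. $\Gamma$ has solvable generic Equality Problem if there exist a finite generating set $X$ of $\Gamma$ and a generic subset $S\subset\mathbb F_{\mathsf X}$ such that the EP is solvable on $S$. *)

(* Defs.v *)
From HB Require Import structures.
From mathcomp Require Import all_boot all_order all_algebra finmap.
From mathcomp Require Import boolp classical_sets functions cardinality.
From mathcomp Require Import topology normedtype sequences.

Set Implicit Arguments.
Unset Strict Implicit.
Unset Printing Implicit Defensive.

Import Order.TTheory GRing.Theory Num.Theory.
Import numFieldNormedType.Exports.

Local Open Scope classical_set_scope.
Local Open Scope group_scope.

(* The letter (t, false) stands for the generator t, and (t, true) for its
   inverse. *)
Definition inv_letter (T : Type) (a : T * bool) : T * bool := (a.1, ~~ a.2).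

Lemma inv_letterK (T : Type) : involutive (@inv_letter T).
Proof. by case=> t b; rewrite /inv_letter /= negbK. Qed.

Definition reduced (T : eqType) (w : seq (T * bool)) : bool :=
  sorted (fun a b => b != inv_letter a) w.

Record freeGroup (T : choiceType) : Type :=
  FreeWord { letters :> seq (T * bool); letters_reduced : reduced letters }.

HB.instance Definition _ (T : choiceType) := [isSub for @letters T].
HB.instance Definition _ (T : choiceType) := [Choice of freeGroup T by <:].

Section FreeGroupLaw.
Variable T : choiceType.
Implicit Types (a b : T * bool) (u v w : seq (T * bool)).

Definition cons_reduce a w : seq (T * bool) :=
  if w is b :: w' then if b == inv_letter a then w' else a :: w else [:: a].

Definition word_mul u v : seq (T * bool) := foldr cons_reduce v u.

Definition word_inv w : seq (T * bool) := rev (map (@inv_letter T) w).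

Lemma cons_reduce_reduced a w : reduced w -> reduced (cons_reduce a w).
Proof.
case: w => //= b w; case: ifP => [_ | /negbT ba] /=; last by move=> ->; rewrite ba.
exact: path_sorted.
Qed.

Lemma word_mul_reduced u v : reduced v -> reduced (word_mul u v).
Proof. by move=> rv; elim: u => //= a u; apply: cons_reduce_reduced. Qed.

Lemma word_inv_reduced w : reduced w -> reduced (word_inv w).
Proof.
rewrite /reduced /word_inv rev_sorted sorted_map; apply: sub_sorted => a b /=.
by apply: contra => /eqP/(inv_inj (@inv_letterK T))->; rewrite inv_letterK.
Qed.

Lemma cons_reduceK a w : reduced w ->
  cons_reduce (inv_letter a) (cons_reduce a w) = w.
Proof.
case: w => [|b w] /=; first by rewrite inv_letterK eqxx.
case: eqVneq => [-> | ba] /=; last by rewrite inv_letterK eqxx.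
by case: w => [|c w] //= /andP[/negbTE->].
Qed.

Lemma word_mul_cons a u v : reduced u -> reduced v ->
  word_mul (cons_reduce a u) v = cons_reduce a (word_mul u v).
Proof.
case: u => [|b u] //= ru rv; case: eqVneq => //= ->.
have := cons_reduceK (inv_letter a) (word_mul_reduced u rv).
by rewrite inv_letterK.
Qed.

Lemma word_mulA u v w : reduced v -> reduced w ->
  word_mul u (word_mul v w) = word_mul (word_mul u v) w.
Proof.
by move=> rv rw; elim: u => //= a u ->; rewrite word_mul_cons ?word_mul_reduced.
Qed.

Lemma word_mulw1 w : reduced w -> word_mul w [::] = w.
Proof.
elim: w => //= a w IHw raw; rewrite IHw; last exact: path_sorted raw.
by case: w raw {IHw} => //= b w /andP[/negbTE->].
Qed.

Lemma word_mulVw w v : reduced v -> word_mul (word_inv w) (word_mul w v) = v.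
Proof.
move=> rv; elim: w => //= a w IHw.
rewrite /word_inv /= rev_cons -cats1 /word_mul foldr_cat /= cons_reduceK //.
exact: word_mul_reduced.
Qed.

Lemma word_invK : involutive word_inv.
Proof.
move=> w; rewrite /word_inv map_rev revK -map_comp -[RHS]map_id.
by apply: eq_map => a /=; rewrite inv_letterK.
Qed.

Definition fg_one : freeGroup T := FreeWord (erefl (reduced [::])).
Definition fg_mul (u v : freeGroup T) : freeGroup T :=
  FreeWord (word_mul_reduced u (letters_reduced v)).
Definition fg_inv (w : freeGroup T) : freeGroup T :=
  FreeWord (word_inv_reduced (letters_reduced w)).

Lemma fg_mulA : associative fg_mul.
Proof. by move=> u v w; apply/val_inj/word_mulA; apply: letters_reduced. Qed.

Lemma fg_mul1 : left_id fg_one fg_mul.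
Proof. by move=> w; apply: val_inj. Qed.

Lemma fg_mulr1 : right_id fg_one fg_mul.
Proof. by move=> w; apply/val_inj/word_mulw1/letters_reduced. Qed.

Lemma fg_mulV : left_inverse fg_one fg_inv fg_mul.
Proof.
move=> w; apply: val_inj => /=.
by rewrite -{2}(word_mulw1 (letters_reduced w)) word_mulVw.
Qed.

Lemma fg_mulrV : right_inverse fg_one fg_inv fg_mul.
Proof.
move=> w; rewrite -{1}[w](_ : fg_inv (fg_inv w) = w) ?fg_mulV //.
by apply/val_inj/word_invK.
Qed.

End FreeGroupLaw.

HB.instance Definition _ (T : choiceType) :=
  isGroup.Build (freeGroup T) (@fg_mulA T) (@fg_mul1 T) (@fg_mulr1 T)
    (@fg_mulV T) (@fg_mulrV T).

Section FreeGroupUniversal.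
Variables (T : choiceType) (G : groupType) (x : T -> G).

Definition fg_gen (t : T) : freeGroup T :=
  FreeWord (erefl (reduced [:: (t, false)])).

Definition letter_val (a : T * bool) : G := if a.2 then (x a.1)^-1 else x a.1.

Definition free_lift (w : freeGroup T) : G := \prod_(a <- letters w) letter_val a.

Lemma letter_val_inv a : letter_val (inv_letter a) = (letter_val a)^-1.
Proof. by case: a => t [] //=; rewrite /letter_val /= invgK. Qed.

Lemma free_lift1 : free_lift 1 = 1.
Proof. by rewrite /free_lift big_nil. Qed.

Lemma free_liftM : {morph free_lift : u v / u * v}.
Proof.
move=> [u ru] [v rv]; rewrite /free_lift /= {ru}.
elim: u => [|a u IHu] /=; first by rewrite big_nil mul1g.
rewrite big_cons -mulgA -IHu; case: (word_mul u v) => [|b w] /=.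
  by rewrite big_seq1 big_nil mulg1.
case: eqVneq => [-> | _]; last by rewrite big_cons.
by rewrite big_cons letter_val_inv mulgA mulgV mul1g.
Qed.

HB.instance Definition _ :=
  isUMagmaMorphism.Build (freeGroup T) G free_lift (free_lift1, free_liftM).

Lemma free_lift_gen t : free_lift (fg_gen t) = x t.
Proof. by rewrite /free_lift big_seq1. Qed.

Lemma free_lift_unique (f : {multiplicative freeGroup T -> G}) :
  (forall t, f (fg_gen t) = x t) -> f =1 free_lift.
Proof.
move=> fx; have f1 : f 1 = 1 by apply: (mulgI (f 1)); rewrite -gmulfM !mulg1.
case=> w; elim: w => [|a w IHw] rw.
  rewrite (_ : FreeWord rw = 1) ?f1 ?free_lift1 //; exact: val_inj.
have rw' : reduced w by exact: path_sorted rw.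
have ra : reduced [:: a] by [].
have -> : FreeWord rw = FreeWord ra * FreeWord rw'.
  apply: val_inj => /=; case: (w) rw => //= b w' /andP[/negbTE-> _] //.
rewrite gmulfM IHw free_liftM; congr (_ * _).
rewrite [RHS]/free_lift big_seq1; case: a ra {rw} => t [] ra.
  rewrite (_ : FreeWord ra = (fg_gen t)^-1); last exact: val_inj.
  apply: (mulgI (f (fg_gen t))); rewrite -gmulfM mulgV f1 fx.
  by rewrite /letter_val mulgV.
by rewrite (_ : FreeWord ra = fg_gen t) ?fx //; exact: val_inj.
Qed.

End FreeGroupUniversal.

Definition is_subgroup (G : groupType) (H : set G) : Prop :=
  H 1 /\ forall g h, H g -> H h -> H (g / h).

Definition is_normal_subgroup (G : groupType) (H : set G) : Prop :=
  is_subgroup H /\ forall g h, H g -> H (g ^ h).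

(* A finite generating set of [k] elements is given by an enumeration
   [x : 'I_k -> G], which is also the bijection from the basis ['I_k] of the
   free group; [free_lift x] is the epimorphism onto [G] that extends it. *)
Definition generating (G : groupType) (k : nat) (x : 'I_k -> G) : Prop :=
  injective x /\ smallest (@is_subgroup G) (range x) = [set: G].

Lemma free_lift_surj (G : groupType) (k : nat) (x : 'I_k -> G) :
  generating x -> range (free_lift x) = [set: G].
Proof.
case=> _ gx; apply/seteqP; split=> // g _.
have : [set: G] g by [].
rewrite -gx; apply; split; last first.
  by move=> _ [i _ <-]; exists (fg_gen i) => //; rewrite free_lift_gen.
split; first by exists 1; rewrite ?free_lift1.
move=> _ _ [u _ <-] [v _ <-]; exists (u / v) => //.
by rewrite gmulfF.
Qed.

Definition fg_kernel (G : groupType) (k : nat) (x : 'I_k -> G) :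
  set (freeGroup 'I_k) := free_lift x @^-1` [set 1].

(* A partial function from nat^n to nat is represented by its graph. *)
Definition pfun (n : nat) : Type := n.-tuple nat -> nat -> Prop.

Definition pf_comp m n (f : pfun m) (g : 'I_m -> pfun n) : pfun n :=
  fun t v => exists2 s : m.-tuple nat, (forall i, g i t (tnth s i)) & f s v.

Fixpoint pf_iter n (f : pfun n) (g : pfun n.+2) (t : n.-tuple nat) (y v : nat) :
    Prop :=
  if y is y'.+1 then
    exists2 r, pf_iter f g t y' r & g [tuple of y' :: r :: t] v
  else f t v.

Definition pf_rec n (f : pfun n) (g : pfun n.+2) : pfun n.+1 :=
  fun t v => pf_iter f g [tuple of behead t] (thead t) v.

Definition pf_min n (f : pfun n.+1) : pfun n :=
  fun t y => f [tuple of y :: t] 0%N /\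
    forall z, (z < y)%N -> exists v, f [tuple of z :: t] v.+1.

(* Kleene's partial recursive functions. *)
Inductive partial_recursive : forall n, pfun n -> Prop :=
| PR_zero n : @partial_recursive n (fun _ v => v = 0%N)
| PR_succ : @partial_recursive 1 (fun t v => v = (thead t).+1)
| PR_proj n (i : 'I_n) : @partial_recursive n (fun t v => v = tnth t i)
| PR_comp m n (f : pfun m) (g : 'I_m -> pfun n) :
    partial_recursive f -> (forall i, partial_recursive (g i)) ->
    partial_recursive (pf_comp f g)
| PR_rec n (f : pfun n) (g : pfun n.+2) :
    partial_recursive f -> partial_recursive g ->
    partial_recursive (pf_rec f g)
| PR_min n (f : pfun n.+1) :
    partial_recursive f -> partial_recursive (pf_min f).

Lemma partial_recursive_functional n (f : pfun n) : partial_recursive f ->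
  forall t v v', f t v -> f t v' -> v = v'.
Proof.
elim=> {n f} [n|//|n i|m n f g _ IHf _ IHg|n f g _ IHf _ IHg|n f _ IHf] t v v'.
- by move=> -> ->.
- by move=> -> ->.
- by move=> -> ->.
- move=> [s gs fs] [s' gs' fs'].
  have ss' : s = s' by apply: eq_from_tnth => i; apply: IHg (gs i) (gs' i).
  by rewrite -ss' in fs'; apply: IHf fs fs'.
- rewrite /pf_rec; elim: (thead t) v v' => [|y IHy] v v' /=; first exact: IHf.
  move=> [r /IHy fr gv] [r' /fr <- gv']; exact: IHg gv gv'.
- move=> [f0 f_lt] [f0' f_lt'].
  case: (ltngtP v v') => // [/f_lt'|/f_lt] [w fw].
    by have := IHf _ _ _ f0 fw.
  by have := IHf _ _ _ f0' fw.
Qed.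

Definition letter_code (k : nat) (a : 'I_k * bool) : nat := (a.1.*2 + a.2)%N.

Definition word_code (k : nat) (w : freeGroup 'I_k) : nat :=
  CodeSeq.code (map (@letter_code k) (letters w)).

Definition recursive_set (k : nat) (A : set (freeGroup 'I_k)) : Prop :=
  exists2 f : pfun 1, partial_recursive f &
    forall w, f [tuple word_code w] (nat_of_bool `[< A w >]).

Definition recursively_presented (G : groupType) : Prop :=
  exists k (x : 'I_k -> G), generating x /\
    exists2 R : set (freeGroup 'I_k), recursive_set R &
      smallest (@is_normal_subgroup (freeGroup 'I_k)) R = fg_kernel x.

Definition amenable (G : groupType) : Prop :=
  exists k (x : 'I_k -> G), generating x /\
    forall n : nat, (0 < n)%N ->
      exists2 Om : {fset G}, Om != fset0 &
        forall i : 'I_k,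
          (#|` (Om `\` [fset (x i * g)%g | g in Om])%fset |%:R / #|` Om|%:R
             <= n%:R^-1 :> rat)%R.

Definition solvable_word_problem (G : groupType) (k : nat) (x : 'I_k -> G) :
  Prop := recursive_set (fg_kernel x).

(* Nothing is required of [f] outside S x S: there it may be undefined or give
   a wrong answer. *)
Definition solvable_EP_on (G : groupType) (k : nat) (x : 'I_k -> G)
    (S : set (freeGroup 'I_k)) : Prop :=
  exists2 f : pfun 2, partial_recursive f &
    forall u v, S u -> S v ->
      f [tuple word_code u; word_code v]
        (nat_of_bool (free_lift x u == free_lift x v)).

Definition fg_ball (k n : nat) : set (freeGroup 'I_k) :=
  [set w | (size (letters w) <= n)%N].

(* Needed for [fset_set] below to be meaningful: it is empty on infinite sets. *)
Lemma finite_fg_ball (k n : nat) : finite_set (@fg_ball k n).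
Proof.
pose f (s : n.-bseq ('I_k * bool)) : freeGroup 'I_k :=
    insubd (1 : freeGroup 'I_k) (s : seq ('I_k * bool)).
apply: (@sub_finite_set _ _ (f @` [set: n.-bseq ('I_k * bool)])); last first.
  exact/finite_image/finite_finset.
move=> w wn; exists (Bseq wn) => //; apply: val_inj.
by rewrite val_insubd /= letters_reduced.
Qed.

Definition generic (k : nat) (S : set (freeGroup 'I_k)) : Prop :=
  (fun n : nat => #|` fset_set (S `&` @fg_ball k n)|%:R
     / #|` fset_set (@fg_ball k n)|%:R : rat^o)%R @ \oo --> (1%R : rat^o).

Definition solvable_generic_EP (G : groupType) : Prop :=
  exists k (x : 'I_k -> G) (S : set (freeGroup 'I_k)),
    [/\ generating x, generic S & solvable_EP_on x S].

(* Main.v *)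
Require Import Defs.
From mathcomp Require Import all_boot all_order all_algebra finmap.
From mathcomp Require Import boolp classical_sets functions cardinality.
From mathcomp Require Import topology normedtype sequences zify.

Set Implicit Arguments.
Unset Strict Implicit.
Unset Printing Implicit Defensive.

Import Order.TTheory GRing.Theory Num.Theory.
Import numFieldNormedType.Exports.

(** Let [f] decide the Equality Problem on a generic set [S], for a generating
    set of [k >= 2] elements, and put [q = 2k - 1]. Write the word to be tested
    as [w = u v] with halves of almost equal length, and pick letters [a], [b]
    such that [p = a v^-1 b] and [p' = a u b] are reduced. Exchanging [p] for
    [p'] inside a reduced word [s] multiplies [s] by a conjugate of [w], so the
    result [s'] equals [s] in the group if and only if [w] does equal [1]. Cut
    [s] into blocks and make the exchange in the first block that contains [p]
    or the prefix of [p'] of the same length, provided that it contains [p]: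
    this map is injective, it changes lengths by at most one, and it is defined
    on at least 3/8 of the words of a given large length that may follow a given
    letter. Since the complement of [S] has a proportion as small as we like of
    all large balls (with a threshold that is a fixed constant), most pairs [(s,
    s')] lie in [S x S]: the answer of [f] on such pairs which is given for a
    definite proportion of them is correct, and it is found by dovetailing. A
    group with at most one generator is cyclic, and the solvability of the Word
    Problem does not depend on the generating set. *)

(** * Recursive functions of environments *)

Lemma partial_recursive_ext n (f g : pfun n) :
  (forall t v, f t v <-> g t v) -> partial_recursive f -> partial_recursive g.
Proof.
by move=> fg; suff -> : f = g by []; apply/funext=> t; apply/funext=> v; apply/propext.
Qed.

Definition total_recursive n (F : n.-tuple nat -> nat) : Prop :=
  partial_recursive (fun t v => v = F t).

Lemma total_recursive_ext n (F G : n.-tuple nat -> nat) :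
  F =1 G -> total_recursive F -> total_recursive G.
Proof. by move=> FG; apply: partial_recursive_ext => t v; rewrite FG. Qed.

Lemma partial_recursive_comp m n (f : pfun m) (G : 'I_m -> n.-tuple nat -> nat) :
  partial_recursive f -> (forall i, total_recursive (G i)) ->
  partial_recursive (fun t v => f [tuple G i t | i < m] v).
Proof.
move=> rf rG; apply: partial_recursive_ext (PR_comp rf rG) => t v.
split=> [[s Gs fs]|fv].
  suff <- : s = [tuple G i t | i < m] by [].
  by apply: eq_from_tnth => i; rewrite tnth_mktuple Gs.
by exists [tuple G i t | i < m] => // i; rewrite tnth_mktuple.
Qed.

Lemma total_recursive_succ n (F : n.-tuple nat -> nat) :
  total_recursive F -> total_recursive (fun t => (F t).+1).
Proof.
move=> rF; apply: partial_recursive_ext (partial_recursive_comp PR_succ (fun=> rF)) => t v.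
by rewrite /thead tnth_mktuple.
Qed.

Lemma total_recursive_const n c : total_recursive (fun _ : n.-tuple nat => c).
Proof.
elim: c => [|c IHc]; first exact: PR_zero.
exact: total_recursive_succ.
Qed.

Lemma pf_rec_cons n (f : pfun n) (g : pfun n.+2) y (t : n.-tuple nat) v :
  pf_rec f g [tuple of y :: t] v = pf_iter f g t y v.
Proof. by rewrite /pf_rec theadE; congr (pf_iter f g _ y v); apply: val_inj. Qed.

(* Environments [nat -> nat] that vanish almost everywhere stand for tuples of
   unspecified length. *)
Definition computable (F : (nat -> nat) -> nat) : Prop :=
  forall m, total_recursive (fun t : m.-tuple nat => F (nth 0 t)).

Definition supported m (e : nat -> nat) : Prop := forall i, m <= i -> e i = 0.

Lemma computable_var i : computable (fun e => e i).
Proof.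
move=> m; case: (ltnP i m) => [im|mi].
  by apply: total_recursive_ext (PR_proj (Ordinal im)) => t; rewrite (tnth_nth 0).
apply: total_recursive_ext (total_recursive_const m 0) => t.
by rewrite nth_default ?size_tuple.
Qed.

Lemma computable_const c : computable (fun=> c).
Proof. by move=> m; apply: total_recursive_const. Qed.

(** The last hypothesis bounds the support of the new environment, so that a single arity [M] of [F]
    serves for all tuples of length [m]. *)
Lemma computable_subst F (s : nat -> (nat -> nat) -> nat) :
  computable F -> (forall i, computable (s i)) ->
  (forall m, exists M, forall e i, supported m e -> M <= i -> s i e = 0) ->
  computable (fun e => F (s^~ e)).
Proof.
move=> cF cs fin_s m; have [M sM] := fin_s m.
apply: partial_recursive_ext
  (partial_recursive_comp (cF M) (fun i : 'I_M => cs i m)) => t v.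
suff -> : nth 0 [tuple s i (nth 0 t) | i < M] = s^~ (nth 0 t) by [].
apply/funext => i; case: (ltnP i M) => [iM|Mi].
  by rewrite (nth_mktuple _ _ (Ordinal iM)).
rewrite nth_default ?size_tuple // sM // => j mj.
by rewrite nth_default ?size_tuple.
Qed.

Lemma computable1 f a : computable (fun e => f (e 0)) ->
  computable a -> computable (fun e => f (a e)).
Proof.
move=> cf ca; pose s i e := if i is 0 then a e else 0.
apply: (computable_subst (s := s) cf) => [[]//|m].
  by move=> n; apply: computable_const.
by exists 1 => e [].
Qed.

Lemma computable2 f a b : computable (fun e => f (e 0) (e 1)) ->
  computable a -> computable b -> computable (fun e => f (a e) (b e)).
Proof.
move=> cf ca cb; pose s i e := if i is j.+1 then if j is 0 then b e else 0 else a e.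
apply: (computable_subst (s := s) cf) => [[|[|n]]//|m].
  exact: computable_const.
by exists 2 => e [|[]].
Qed.

Lemma computable_succ a : computable a -> computable (fun e => (a e).+1).
Proof. by move=> ca m; apply: total_recursive_succ. Qed.

(** Variable [0] of the iterated function is the counter, variable [1] the value reached so far, and
    the old environment is shifted by two: this is the argument order of [pf_rec]. *)
Lemma computable_iteri (a b : (nat -> nat) -> nat) (g : nat -> nat -> (nat -> nat) -> nat) :
  computable a -> computable b ->
  computable (fun e => g (e 0) (e 1) (fun i => e i.+2)) ->
  computable (fun e => iteri (a e) (fun y r => g y r e) (b e)).
Proof.
move=> ca cb cg m.
pose G (i : 'I_m.+1) (t : m.-tuple nat) : nat :=
  if unlift ord0 i is Some j then tnth t j else a (nth 0 t).
have rG i : total_recursive (G i).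
  by rewrite /G; case: (unlift ord0 i) => [j|]; [apply: PR_proj | apply: ca].
apply: partial_recursive_ext (partial_recursive_comp (PR_rec (cb m) (cg m.+2)) rG) => t v.
have -> : [tuple G i t | i < m.+1] = [tuple of a (nth 0 t) :: t].
  apply: eq_from_tnth => i; rewrite tnth_mktuple /G.
  by case: (unliftP ord0 i) => [j ->|->] //; rewrite tnthS.
rewrite pf_rec_cons.
elim: (a _) v => //= y IHy v; split=> [[r /IHy-> ->]//|->].
by eexists; first exact/IHy.
Qed.

(** A zero of [R] is guaranteed to exist, so unbounded minimization is total and no bound on the
    search has to be computed. *)
Lemma computable_min (R : nat -> (nat -> nat) -> nat) (F : (nat -> nat) -> nat) :
  computable (fun e => R (e 0) (fun i => e i.+1)) ->
  (forall e, R (F e) e = 0 /\ forall z, z < F e -> 0 < R z e) -> computable F.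
Proof.
move=> cR RF m; apply: partial_recursive_ext (PR_min (cR m.+1)) => t v.
have [R0 Rlt] := RF (nth 0 t); split=> [[/= Rv vlt]|->{v}].
  case: (ltngtP v (F (nth 0 t))) => // [/Rlt|/vlt[w]]; first by rewrite -Rv.
  by rewrite -[X in w.+1 = X]/(R (F (nth 0 t)) (nth 0 t)) R0.
split=> [|z /Rlt Rz]; first exact/esym.
by exists (R z (nth 0 t)).-1; rewrite prednK.
Qed.

Lemma computable_ext F G : F =1 G -> computable F -> computable G.
Proof. by move/funext->. Qed.

Lemma computable_shift j F : computable F -> computable (fun e => F (fun i => e (j + i))).
Proof.
move=> cF; apply: (computable_subst (s := fun i e => e (j + i)) cF) => [i|m].
  exact: computable_var.
by exists m => e i me mi; apply: me; rewrite (leq_trans mi) ?leq_addl.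
Qed.

Lemma computable_addn a b : computable a -> computable b ->
  computable (fun e => a e + b e).
Proof.
move=> ca cb.
have := computable_iteri (g := fun _ r _ => r.+1) ca cb (computable_succ (computable_var 1)).
by apply: computable_ext => e; elim: (a e) => //= n ->.
Qed.

Lemma computable_predn a : computable a -> computable (fun e => (a e).-1).
Proof.
move=> ca.
have := computable_iteri (g := fun y _ _ => y) ca (computable_const 0) (computable_var 0).
by apply: computable_ext => e; case: (a e).
Qed.

Lemma computable_subn a b : computable a -> computable b ->
  computable (fun e => a e - b e).
Proof.
move=> ca cb; have := computable_iteri (g := fun _ r _ => r.-1) cb ca
  (computable_predn (computable_var 1)).
by apply: computable_ext => e; elim: (b e) => [|n /= ->] /=; lia.
Qed.

Lemma computable_muln a b : computable a -> computable b ->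
  computable (fun e => a e * b e).
Proof.
move=> ca cb; have := computable_iteri (g := fun _ r e => r + b e) ca (computable_const 0)
  (computable_addn (computable_var 1) (computable_shift 2 cb)).
by apply: computable_ext => e; elim: (a e) => [|n /= ->] /=; lia.
Qed.

Lemma computable_expn a b : computable a -> computable b ->
  computable (fun e => a e ^ b e).
Proof.
move=> ca cb; have := computable_iteri (g := fun _ r e => r * a e) cb (computable_const 1)
  (computable_muln (computable_var 1) (computable_shift 2 ca)).
by apply: computable_ext => e; elim: (b e) => // n /= ->; rewrite expnS mulnC.
Qed.

(** * Decidable predicates and searches *)

Definition computable_pred (P : (nat -> nat) -> bool) : Prop :=
  computable (fun e => nat_of_bool (P e)).

Lemma computable_neg P : computable_pred P -> computable_pred (fun e => ~~ P e).
Proof.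
move=> cP; apply: computable_ext (computable_subn (computable_const 1) cP) => e.
by case: (P e).
Qed.

Lemma computable_and P Q : computable_pred P -> computable_pred Q ->
  computable_pred (fun e => P e && Q e).
Proof.
move=> cP cQ; apply: computable_ext (computable_muln cP cQ) => e.
by rewrite mulnb.
Qed.

Lemma computable_or P Q : computable_pred P -> computable_pred Q ->
  computable_pred (fun e => P e || Q e).
Proof.
move=> cP cQ.
apply: computable_ext (computable_neg (computable_and (computable_neg cP) (computable_neg cQ))).
by move=> e; rewrite negb_and !negbK.
Qed.

Lemma computable_leq a b : computable a -> computable b ->
  computable_pred (fun e => a e <= b e).
Proof.
move=> ca cb; apply: computable_ext (computable_subn (computable_const 1) (computable_subn ca cb)).
by move=> e; rewrite /leq; case: (a e - b e).
Qed.

Lemma computable_eqn a b : computable a -> computable b ->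
  computable_pred (fun e => a e == b e).
Proof.
move=> ca cb; apply: computable_ext (computable_and (computable_leq ca cb) (computable_leq cb ca)).
by move=> e; rewrite eqn_leq.
Qed.

Lemma computable_if P a b : computable_pred P -> computable a -> computable b ->
  computable (fun e => if P e then a e else b e).
Proof.
move=> cP ca cb; apply: computable_ext (computable_addn (computable_muln cP ca)
  (computable_muln (computable_neg cP) cb)).
by move=> e; case: (P e); lia.
Qed.

Lemma computable_has P b : computable b ->
  computable_pred (fun e => P (e 0) (fun i => e i.+1)) ->
  computable_pred (fun e => has (P^~ e) (iota 0 (b e))).
Proof.
move=> cb cP; pose g y r e := nat_of_bool ((r != 0) || P y e).
have cg : computable (fun e => g (e 0) (e 1) (fun i => e i.+2)).
  apply: (@computable_or (fun e => e 1 != 0) (fun e => P (e 0) (fun i => e i.+2))).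
    exact: computable_neg (computable_eqn (computable_var 1) (computable_const 0)).
  (* Variable [1] holds the truth value accumulated by the iteration, and [P] must skip it. *)
  apply: (computable_subst (s := fun i e => if i is j.+1 then e j.+2 else e 0) cP).
    by case=> [|i]; apply: computable_var.
  by move=> m; exists m => e [|i] me mi; apply: me; lia.
apply: computable_ext (computable_iteri cb (computable_const 0) cg) => e.
elim: (b e) => // n IHn; have -> : iota 0 n.+1 = rcons (iota 0 n) n.
  by rewrite -cats1 -[n.+1]addn1 iotaD.
by rewrite has_rcons /= IHn /g orbC; case: (has _ _).
Qed.

Lemma computable_all P b : computable b ->
  computable_pred (fun e => P (e 0) (fun i => e i.+1)) ->
  computable_pred (fun e => all (P^~ e) (iota 0 (b e))).
Proof.
move=> cb cP.
have /= := computable_neg (computable_has (P := fun x e => ~~ P x e) cb (computable_neg cP)).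
by apply: computable_ext => e; rewrite -all_predC; congr nat_of_bool; apply: eq_all => x /=; rewrite negbK.
Qed.

Lemma computable_least (P : nat -> (nat -> nat) -> bool) (F : (nat -> nat) -> nat) :
  computable_pred (fun e => P (e 0) (fun i => e i.+1)) ->
  (forall e, P (F e) e /\ forall z, z < F e -> ~~ P z e) -> computable F.
Proof.
move=> cP PF; apply: (computable_min (R := fun z e => nat_of_bool (~~ P z e))).
  exact: (computable_neg cP).
by move=> e; have [-> Pz] := PF e; split=> // z /Pz->.
Qed.

Lemma computable_find P b : computable b ->
  computable_pred (fun e => P (e 0) (fun i => e i.+1)) ->
  computable (fun e => find (P^~ e) (iota 0 (b e))).
Proof.
(* On failure [find] returns [b e]; the disjunct [b e <= z] stops the minimization there. *)
move=> cb cP; apply: (computable_least (P := fun z e => (b e <= z) || P z e)).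
  by apply: computable_or cP; apply: computable_leq (computable_shift 1 cb) (computable_var 0).
move=> e; split=> [|z zlt].
  case: leqP => //= lt_b; have /(nth_find 0) : has (P^~ e) (iota 0 (b e)).
    by rewrite has_find size_iota.
  by rewrite nth_iota.
have zb : z < b e by rewrite (leq_trans zlt) // -[X in _ <= X](size_iota 0) find_size.
by have := before_find 0 zlt; rewrite nth_iota // leqNgt zb => ->.
Qed.

(** * Codes of lists of numbers *)

Definition hd (c : nat) : nat := head 0 (CodeSeq.decode c).
Definition tl (c : nat) : nat := CodeSeq.code (behead (CodeSeq.decode c)).
Definition cnth (c i : nat) : nat := nth 0 (CodeSeq.decode c) i.
Definition csize (c : nat) : nat := size (CodeSeq.decode c).

Lemma code_cons a s : CodeSeq.code (a :: s) = 2 ^ a * (CodeSeq.code s).*2.+1.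
Proof. by []. Qed.

Lemma hd_tl c : 0 < c -> c = 2 ^ hd c * (tl c).*2.+1.
Proof.
rewrite /hd /tl -{1 2}(CodeSeq.decodeK c); case: (CodeSeq.decode c) => //= a s.
Qed.

(** A positive number is in only one way a power of two times an odd number, so the searches for
    head and tail have a single possible answer. *)
Lemma hd_tl_unique c a t : c = 2 ^ a * t.*2.+1 -> hd c = a /\ tl c = t.
Proof.
move=> ->; rewrite -(CodeSeq.decodeK t) -code_cons /hd /tl CodeSeq.codeK /=.
by rewrite CodeSeq.decodeK.
Qed.

Lemma decode_tl c : CodeSeq.decode (tl c) = behead (CodeSeq.decode c).
Proof. by rewrite /tl CodeSeq.codeK. Qed.

Lemma decode_eq0 c : (CodeSeq.decode c == [::]) = (c == 0).
Proof. by apply/eqP/eqP => [dc|->//]; rewrite -(CodeSeq.decodeK c) dc. Qed.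

Lemma tl_lt c : 0 < c -> tl c < c.
Proof.
move=> c0; rewrite {2}(hd_tl c0); have := expn_gt0 2 (hd c); nia.
Qed.

Lemma computable_double_succ a : computable a -> computable (fun e => (a e).*2.+1).
Proof.
move=> ca; apply: computable_ext (computable_succ (computable_addn ca ca)) => e.
by rewrite addnn.
Qed.

Lemma computable_hd a : computable a -> computable (fun e => hd (a e)).
Proof.
(* The code [0] is that of the empty list, whose head defaults to [0]: the search must then succeed
   at once. *)
apply: computable1; apply: (computable_least (P := fun z e =>
  (e 0 == 0) || has (fun t => e 0 == 2 ^ z * t.*2.+1) (iota 0 (e 0)))).
  apply: computable_or; first exact: computable_eqn (computable_var 1) (computable_const 0).
  apply: (computable_has (P := fun t e => e 1 == 2 ^ e 0 * t.*2.+1)); first exact: computable_var.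
  apply: computable_eqn; first exact: computable_var.
  apply: computable_muln (computable_double_succ (computable_var 0)).
  exact: computable_expn (computable_const 2) (computable_var 1).
move=> e; case: posnP => [->|e0] //=; split=> [|z zlt]; last first.
  apply/hasPn => t _; apply/eqP => /hd_tl_unique[hz _].
  by rewrite hz ltnn in zlt.
apply/hasP; exists (tl (e 0)); first by rewrite mem_iota /= tl_lt.
exact/eqP/hd_tl.
Qed.

Lemma computable_tl a : computable a -> computable (fun e => tl (a e)).
Proof.
apply: computable1; apply: (computable_least (P := fun z e =>
  (e 0 == 0) || (e 0 == 2 ^ hd (e 0) * z.*2.+1))).
  apply: computable_or; first exact: computable_eqn (computable_var 1) (computable_const 0).
  apply: computable_eqn; first exact: computable_var.
  apply: computable_muln (computable_double_succ (computable_var 0)).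
  exact: computable_expn (computable_const 2) (computable_hd (computable_var 1)).
move=> e; case: posnP => [->|e0] //=; split=> [|z zlt]; last first.
  by apply/eqP => /hd_tl_unique[_ hz]; rewrite hz ltnn in zlt.
exact/eqP/hd_tl.
Qed.

Lemma decode_iter_tl i c : CodeSeq.decode (iteri i (fun=> tl) c) = drop i (CodeSeq.decode c).
Proof.
elim: i => [|i IHi] /=; first by rewrite drop0.
by rewrite decode_tl IHi -drop1 drop_drop.
Qed.

Lemma computable_iter_tl a b : computable a -> computable b ->
  computable (fun e => iteri (a e) (fun=> tl) (b e)).
Proof.
move=> ca cb; apply: (computable_iteri (g := fun _ r _ => tl r)) => //.
exact: computable_tl (computable_var 1).
Qed.

Lemma computable_cnth a b : computable a -> computable b ->
  computable (fun e => cnth (a e) (b e)).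
Proof.
move=> ca cb; apply: computable_ext (computable_hd (computable_iter_tl cb ca)) => e.
by rewrite /hd decode_iter_tl -nth0 nth_drop addn0.
Qed.

(** The length is the least number of tails to be taken before the code becomes [0]. *)
Lemma computable_csize a : computable a -> computable (fun e => csize (a e)).
Proof.
apply: computable1; apply: (computable_least (P := fun z e => iteri z (fun=> tl) (e 0) == 0)).
  apply: computable_eqn (computable_const 0).
  exact: computable_iter_tl (computable_var 0) (computable_var 1).
move=> e; split=> [|z zlt]; rewrite -decode_eq0 decode_iter_tl -size_eq0 size_drop.
  by rewrite subnn.
by rewrite subn_eq0 -ltnNge zlt.
Qed.

Lemma computable_ccons a b : computable a -> computable b ->
  computable (fun e => 2 ^ a e * (b e).*2.+1).
Proof.
move=> ca cb; apply: computable_muln (computable_double_succ cb).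
exact: computable_expn (computable_const 2) ca.
Qed.

Lemma foldl_iteri (T R : Type) (g : R -> T -> R) (x0 : T) s r :
  foldl g r s = iteri (size s) (fun i r => g r (nth x0 s i)) r.
Proof.
elim/last_ind: s => // s a IHs; rewrite size_rcons foldl_rcons IHs /=.
rewrite nth_rcons ltnn eqxx; congr (g _ a).
have: size s <= size s by [].
by elim: {-2}(size s) => //= n IHn ns; rewrite IHn ?nth_rcons ?ns // ltnW.
Qed.

Lemma computable_foldl g a b : computable (fun e => g (e 0) (e 1)) ->
  computable a -> computable b ->
  computable (fun e => foldl g (b e) (CodeSeq.decode (a e))).
Proof.
move=> cg ca cb.
have cg' : computable (fun e => g (e 1) (cnth (a (fun i => e i.+2)) (e 0))).
  apply: computable2 cg (computable_var 1) _.
  exact: computable_cnth (computable_shift 2 ca) (computable_var 0).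
apply: computable_ext (computable_iteri (g := fun y r e => g r (cnth (a e) y))
  (computable_csize ca) cb cg') => e.
by rewrite (foldl_iteri _ 0).
Qed.

(** * Semidecidable predicates *)

Definition scons (x : nat) (e : nat -> nat) (i : nat) : nat :=
  if i is j.+1 then e j else x.

(** The number [s] is a stage of the search. Monotonicity in [s] allows several searches to be
    combined at a common stage. *)
Definition semidecidable (P : (nat -> nat) -> Prop) : Prop :=
  exists R : nat -> (nat -> nat) -> bool,
    [/\ computable_pred (fun e => R (e 0) (fun i => e i.+1)),
        forall e, P e <-> exists s, R s e &
        forall e s s', s <= s' -> R s e -> R s' e].

Lemma semidecidable_ext P Q : (forall e, P e <-> Q e) -> semidecidable P -> semidecidable Q.
Proof.
by move=> PQ [R [cR PR mR]]; exists R; split=> // e; rewrite -PQ PR.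
Qed.

Lemma semidecidable_pred P : computable_pred P -> semidecidable (fun e => P e).
Proof.
move=> cP; exists (fun _ e => P e); split=> // [|e].
  exact: (computable_shift 1 cP).
by split=> [Pe|[]//]; exists 0.
Qed.

Lemma semidecidable_and P Q : semidecidable P -> semidecidable Q ->
  semidecidable (fun e => P e /\ Q e).
Proof.
move=> [R [cR PR mR]] [R' [cR' PR' mR']].
exists (fun s e => R s e && R' s e); split=> [|e|e s s' ss'].
- exact: computable_and cR cR'.
- rewrite PR PR'; split=> [[[s Rs] [s' Rs']]|[s /andP[Rs Rs']]].
    by exists (maxn s s'); rewrite (mR _ _ _ _ Rs) ?(mR' _ _ _ _ Rs') ?leq_maxl ?leq_maxr.
  by split; exists s.
- by case/andP=> /(mR _ _ _ ss')-> /(mR' _ _ _ ss').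
Qed.

Lemma semidecidable_or P Q : semidecidable P -> semidecidable Q ->
  semidecidable (fun e => P e \/ Q e).
Proof.
move=> [R [cR PR mR]] [R' [cR' PR' mR']].
exists (fun s e => R s e || R' s e); split=> [|e|e s s' ss'].
- exact: computable_or cR cR'.
- rewrite PR PR'; split=> [[[s Rs]|[s Rs]]|[s /orP[Rs|Rs]]].
  + by exists s; rewrite Rs.
  + by exists s; rewrite Rs orbT.
  + by left; exists s.
  + by right; exists s.
- by case/orP=> [/(mR _ _ _ ss')->|/(mR' _ _ _ ss')->] //; rewrite orbT.
Qed.

(** Dovetailing: the stage [s] bounds at once the witness [x] and the effort spent on it. *)
Lemma semidecidable_ex (P : nat -> (nat -> nat) -> Prop) :
  semidecidable (fun e => P (e 0) (fun i => e i.+1)) ->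
  semidecidable (fun e => exists x, P x e).
Proof.
move=> [R [cR PR mR]].
exists (fun s e => has (fun x => R s (scons x e)) (iota 0 s)); split=> [|e|e s s' ss'].
- apply: (computable_has (P := fun x e => R (e 0) (scons x (fun i => e i.+1)))).
    exact: computable_var.
  (* Variables [0] and [1] are exchanged, since [computable_has] puts the witness in front of the
     stage. *)
  pose s i (e : nat -> nat) := if i is j.+2 then e j.+2 else e (1 - i).
  apply: (computable_subst (s := s) cR) => [[|[|i]]|m]; try exact: computable_var.
  by exists m.+2 => e [|[|i]] // me mi; apply: me; lia.
- split=> [[x /(PR (scons x e))[s Rs]]|[s /hasP[x _ Rx]]].
    exists (maxn s x.+1); apply/hasP; exists x; last by apply: mR Rs; lia.
    by rewrite mem_iota /= add0n leq_maxr.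
  by exists x; apply/(PR (scons x e)); exists s.
- move=> /hasP[x xs Rx]; apply/hasP; exists x; last exact: mR Rx.
  by move: xs; rewrite !mem_iota; lia.
Qed.

(** Finitely many searches that succeed have a common stage of success, by monotonicity. *)
Lemma semidecidable_bounded_all (P : nat -> (nat -> nat) -> Prop) b :
  computable b -> semidecidable (fun e => P (e 0) (fun i => e i.+1)) ->
  semidecidable (fun e => forall x, x < b e -> P x e).
Proof.
move=> cb [R [cR PR mR]].
exists (fun s e => all (fun x => R s (scons x e)) (iota 0 (b e))); split=> [|e|e s s' ss'].
- apply: (computable_all (P := fun x e => R (e 0) (scons x (fun i => e i.+1)))).
    exact: (computable_shift 1 cb).
  pose s i (e : nat -> nat) := if i is j.+2 then e j.+2 else e (1 - i).
  apply: (computable_subst (s := s) cR) => [[|[|i]]|m]; try exact: computable_var.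
  by exists m.+2 => e [|[|i]] // me mi; apply: me; lia.
- split=> [|[s /allP Rs] x xb]; last first.
    by apply/(PR (scons x e)); exists s; apply: Rs; rewrite mem_iota.
  elim: (b e) => [|n IHn] Pn; first by exists 0.
  have [x xn|s Rs] := IHn; first by apply: Pn; apply: ltnW.
  have [s' Rs'] := (PR (scons n e)).1 (Pn n (leqnn _)).
  exists (maxn s s'); apply/allP => x; rewrite mem_iota /= add0n ltnS leq_eqVlt.
  case/orP => [/eqP->|xn]; first by apply: mR Rs'; lia.
  by apply: (mR _ s); [lia | move/allP: Rs; apply; rewrite mem_iota].
- by move=> /allP Rs; apply/allP => x /Rs; apply: mR.
Qed.

Lemma semidecidable_subst P (s : nat -> (nat -> nat) -> nat) :
  semidecidable P -> (forall i, computable (s i)) ->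
  (forall m, exists M, forall e i, supported m e -> M <= i -> s i e = 0) ->
  semidecidable (fun e => P (s^~ e)).
Proof.
move=> [R [cR PR mR]] cs fin_s.
exists (fun z e => R z (s^~ e)); split=> [|e|e z z']; last first.
- exact: mR.
- exact: PR.
pose s' i (e : nat -> nat) := if i is j.+1 then s j (fun i => e i.+1) else e 0.
apply: (computable_subst (s := s') cR) => [[|i]|m].
- exact: computable_var.
- exact: (computable_shift 1 (cs i)).
have [M sM] := fin_s m; exists M.+1 => e [|i] // me Mi; apply: sM => // j mj.
by apply: me; lia.
Qed.

Lemma semidecidable_forall_ord m (P : 'I_m -> (nat -> nat) -> Prop) :
  (forall i, semidecidable (P i)) -> semidecidable (fun e => forall i, P i e).
Proof.
elim: m P => [|m IHm] P sP.
  apply: semidecidable_ext (semidecidable_pred (P := fun=> true) (computable_const 1)) => e.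
  by split=> // _ [].
have sPS := IHm (fun i => P (lift ord0 i)) (fun i => sP (lift ord0 i)).
apply: semidecidable_ext (semidecidable_and (sP ord0) sPS) => e.
by split=> [[P0 PS] i|Pe]; [case: (unliftP ord0 i) => [j|] -> | split].
Qed.

Lemma semidecidable_graph_tuple n (f : pfun n) (a : 'I_n -> (nat -> nat) -> nat) b :
  semidecidable (fun e => f [tuple e i.+1 | i < n] (e 0)) ->
  (forall i, computable (a i)) -> computable b ->
  semidecidable (fun e => f [tuple a i e | i < n] (b e)).
Proof.
move=> sf ca cb.
(* Positions beyond the arity of [f] are filled with [0], which keeps the support bounded. *)
pose s i e := if i is j.+1 then if insub j is Some j' then a j' e else 0 else b e.
apply: semidecidable_ext (semidecidable_subst (s := s) sf _ _) => [e|[|i]|m].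
- suff -> : [tuple s i.+1 e | i < n] = [tuple a i e | i < n] by [].
  by apply: eq_from_tnth => i; rewrite !tnth_mktuple /s valK.
- exact: cb.
- by rewrite /s; case: (insub i) => [j|]; [apply: ca | apply: computable_const].
by exists n.+1 => e [|i] // _ ni; rewrite /s insubF //; apply/negbTE; rewrite -leqNgt.
Qed.

(** * Graphs of partial recursive functions *)

(** The values of the recursion up to [y] form a finite list with code [c], so one existential
    quantifier and local conditions replace the recursion. *)
Lemma pf_iter_history n (f : pfun n) (g : pfun n.+2) t y v :
  pf_iter f g t y v <-> exists c, [/\ cnth c y = v, f t (cnth c 0) &
    forall i, i < y -> g [tuple of i :: cnth c i :: t] (cnth c i.+1)].
Proof.
split=> [fv|[c [<- f0 gS]]]; last first.
  by elim: y gS => //= y IHy gS; exists (cnth c y); [apply: IHy => i iy; apply: gS; lia | apply: gS].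
suff [s [sz sv f0 gS]] : exists s, [/\ size s = y.+1, nth 0 s y = v, f t (nth 0 s 0) &
    forall i, i < y -> g [tuple of i :: nth 0 s i :: t] (nth 0 s i.+1)].
  by exists (CodeSeq.code s); rewrite /cnth CodeSeq.codeK.
elim: y v fv => [|y IHy] v /= => [fv|[r /IHy[s [sz sr f0 gS]] gv]].
  by exists [:: v].
exists (rcons s v); rewrite size_rcons sz !nth_rcons sz ltnn eqxx; split=> // i iy.
have -> : nth 0 (rcons s v) i = nth 0 s i by rewrite nth_rcons sz iy.
have [iy'|yi] := ltnP i y; first by rewrite nth_rcons sz ltnS iy'; apply: gS.
have -> : i = y by lia.
by rewrite nth_rcons sz ltnn eqxx sr.
Qed.

Ltac computable_vars := first [exact: computable_var | exact: computable_const].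

(** Variable [0] is the value, the next [n] are the arguments. Each scheme unfolds into existential
    and bounded universal quantifiers: over a list of intermediate values for composition, a history
    for recursion, the smaller candidates for minimization. *)
Lemma semidecidable_graph n (f : pfun n) : partial_recursive f ->
  semidecidable (fun e => f [tuple e i.+1 | i < n] (e 0)).
Proof.
elim=> {n f}.
- move=> n; apply: semidecidable_ext (semidecidable_pred
    (computable_eqn (computable_var 0) (computable_const 0))) => e.
  by split=> [/eqP|->].
- apply: semidecidable_ext (semidecidable_pred
    (computable_eqn (computable_var 0) (computable_succ (computable_var 1)))) => e.
  by rewrite /thead tnth_mktuple; split=> [/eqP|->].
- move=> n i; apply: semidecidable_ext (semidecidable_pred
    (computable_eqn (computable_var 0) (computable_var i.+1))) => e.
  by rewrite tnth_mktuple; split=> [/eqP|->].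
- move=> m n f g _ sf _ sg.
  have s1 : semidecidable (fun e => exists c, (forall i : 'I_m,
      g i [tuple e j.+1 | j < n] (cnth c i)) /\ f [tuple cnth c i | i < m] (e 0)).
    apply: semidecidable_ex; apply: semidecidable_and.
      apply: (semidecidable_forall_ord (P := fun i e => g i [tuple e j.+2 | j < n] (cnth (e 0) i))) => i.
      apply: (semidecidable_graph_tuple (sg i)) => [j|]; first exact: computable_var.
      exact: computable_cnth (computable_var 0) (computable_const i).
    apply: (semidecidable_graph_tuple sf) => [j|]; last exact: computable_var.
    exact: computable_cnth (computable_var 0) (computable_const j).
  apply: semidecidable_ext s1 => e; split=> [[c [gc fc]]|[s gs fs]].
    by exists [tuple cnth c i | i < m] => // i; rewrite tnth_mktuple; apply: gc.
  exists (CodeSeq.code s); split=> [i|].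
    by rewrite /cnth CodeSeq.codeK -tnth_nth.
  suff -> : [tuple cnth (CodeSeq.code s) i | i < m] = s by [].
  by apply: eq_from_tnth => i; rewrite tnth_mktuple /cnth CodeSeq.codeK -tnth_nth.
- move=> n f g _ sf _ sg.
  (* The default of [nth] varies with the index: the list supplies the first two arguments, and from
     index [2] on the default [e j] supplies the others. *)
  have s1 : semidecidable (fun e => exists c, (cnth c (e 1) == e 0 /\
      f [tuple e i.+2 | i < n] (cnth c 0)) /\ forall i, i < e 1 ->
      g [tuple nth (e (j : 'I_n.+2)) [:: i; cnth c i] j | j < n.+2] (cnth c i.+1)).
    apply: semidecidable_ex; apply: semidecidable_and; [apply: semidecidable_and|].
    + apply: semidecidable_pred; apply: computable_eqn (computable_var 1).
      exact: computable_cnth (computable_var 0) (computable_var 2).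
    + apply: (semidecidable_graph_tuple sf) => [j|]; first exact: computable_var.
      exact: computable_cnth (computable_var 0) (computable_const 0).
    + apply: (semidecidable_bounded_all (P := fun i e =>
        g [tuple nth (e (j : 'I_n.+2).+1) [:: i; cnth (e 0) i] j | j < n.+2] (cnth (e 0) i.+1))).
        exact: computable_var.
      apply: (semidecidable_graph_tuple sg) => [[[|[|j]] jn] /=|].
      * exact: computable_var.
      * exact: computable_cnth (computable_var 1) (computable_var 0).
      * by apply: computable_ext (computable_var j.+4) => e; rewrite nth_nil.
      * exact: computable_cnth (computable_var 1) (computable_succ (computable_var 0)).
  apply: semidecidable_ext s1 => e.
  have -> : [tuple e (i : 'I_n.+1).+1 | i < n.+1] = [tuple of e 1 :: [tuple e i.+2 | i < n]].
    apply: eq_from_tnth => i; rewrite tnth_mktuple.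
    by case: (unliftP ord0 i) => [j|] -> //; rewrite tnthS tnth_mktuple.
  have gE i c : [tuple nth (e (j : 'I_n.+2)) [:: i; cnth c i] j | j < n.+2] =
      [tuple of i :: cnth c i :: [tuple e i.+2 | i < n]].
    apply: eq_from_tnth => j; rewrite tnth_mktuple (tnth_nth 0).
    case: j => [[|[|j]] jn] //=; rewrite nth_nil.
    by rewrite (nth_mktuple _ _ (Ordinal (jn : j < n))).
  rewrite pf_rec_cons pf_iter_history; split=> [[c [[/eqP cy f0] gS]]|[c [cy f0 gS]]]; exists c.
    by split=> // i /gS; rewrite gE.
  by split=> [|i /gS]; [split=> //; apply/eqP | rewrite gE].
- move=> n f _ sf.
  have s1 : semidecidable (fun e => f [tuple e (i : 'I_n.+1) | i < n.+1] 0 /\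
      forall z, z < e 0 -> exists v, f [tuple scons z (fun i => e i.+1) (i : 'I_n.+1) | i < n.+1] v.+1).
    apply: semidecidable_and.
      by apply: (semidecidable_graph_tuple sf) => [i|]; computable_vars.
    apply: (semidecidable_bounded_all (P := fun z e => exists v,
      f [tuple scons z (fun i => e i.+1) (i : 'I_n.+1) | i < n.+1] v.+1)).
      exact: computable_var.
    apply: semidecidable_ex.
    apply: (semidecidable_graph_tuple sf) => [[[|i] ?]|]; try exact: computable_var.
    exact: computable_succ (computable_var 0).
  apply: semidecidable_ext s1 => e.
  have zE z : [tuple scons z (fun i => e i.+1) (i : 'I_n.+1) | i < n.+1] =
      [tuple of z :: [tuple e i.+1 | i < n]].
    apply: eq_from_tnth => i; rewrite tnth_mktuple (tnth_nth 0).
    case: i => [[|i] im] //=.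
    by rewrite (nth_mktuple _ _ (Ordinal (im : i < n))).
  have -> : [tuple e (i : 'I_n.+1) | i < n.+1] = [tuple of e 0 :: [tuple e i.+1 | i < n]].
    by rewrite -zE; apply: eq_from_tnth => i; rewrite !tnth_mktuple; case: i => [[]].
  by split=> -[f0 fS]; split=> // z /fS; rewrite zE.
Qed.

(** The function waits for the first stage [z] that confirms some [v < z] and returns the least such
    [v]. Uniqueness of the value is asked only at the tuple in question, so [G] may be multivalued
    elsewhere. *)
Lemma semidecidable_uniformize n (G : (nat -> nat) -> Prop) : semidecidable G ->
  exists2 f : pfun n, partial_recursive f & forall (t : n.-tuple nat) v,
    G (scons v (nth 0 t)) -> (forall v', G (scons v' (nth 0 t)) -> v' = v) -> f t v.
Proof.
move=> [R [cR GR mR]].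
pose H z v t := R z (scons v t).
pose D z t := has (fun v => H z v t) (iota 0 z).
have cH j : computable_pred (fun e => H (e 1) (e 0) (fun i => e (j + i).+2)).
  pose s i (e : nat -> nat) := if i is k.+2 then e (j + k).+2 else e (1 - i).
  apply: (computable_subst (s := s) cR) => [[|[|i]]|m]; try exact: computable_var.
  by exists m.+2 => e [|[|i]] // me mi; apply: me; lia.
have cD : computable_pred (fun e => ~~ D (e 0) (fun i => e i.+1)).
  apply: computable_neg.
  apply: (computable_has (P := fun v e => H (e 0) v (fun i => e i.+1))).
    exact: computable_var.
  exact: (cH 0).
have ch : computable (fun e => find (fun v => H (e 0) v (fun i => e i.+1)) (iota 0 (e 0))).
  apply: (computable_find (P := fun v e => H (e 0) v (fun i => e i.+1))).
    exact: computable_var.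
  exact: (cH 0).
(* Minimization supplies the stage as first argument; projections pass on the inputs. *)
pose q : 'I_n.+1 -> pfun n := fun i =>
  if unlift ord0 i is Some j then fun t v => v = tnth t j
  else pf_min (fun (t : n.+1.-tuple nat) v => v = ~~ D (nth 0 t 0) (fun i => nth 0 t i.+1)).
exists (pf_comp (fun t v => v = find (fun v => H (nth 0 t 0) v (fun i => nth 0 t i.+1))
   (iota 0 (nth 0 t 0))) q).
  apply: PR_comp => [|i]; first exact: (ch n.+1).
  rewrite /q; case: (unlift ord0 i) => [j|]; first exact: PR_proj.
  exact/PR_min/(cD n.+1).
move=> t v /GR[s Rs] uniq_v.
have exD : exists z, D z (nth 0 t).
  exists (maxn s v.+1); apply/hasP; exists v; last by apply: mR Rs; lia.
  by rewrite mem_iota; lia.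
case: (ex_minnP exD) => z Dz min_z.
exists [tuple of z :: t] => [i|].
  rewrite /q; case: (unliftP ord0 i) => [j|] ->; first by rewrite tnthS.
  rewrite tnth0; split=> [|y yz] /=; first by rewrite Dz.
  exists 0; rewrite (_ : D y _ = false) //; apply: contraTF yz => /min_z.
  by rewrite leqNgt.
rewrite /=; set w := find _ _; apply/esym/uniq_v/GR; exists z.
have := nth_find 0 Dz; rewrite nth_iota //.
by move: Dz; rewrite /D has_find size_iota.
Qed.

Lemma semidecidable_graph_map n (f : pfun n) (a : n.-tuple ((nat -> nat) -> nat)) b :
  partial_recursive f -> (forall i, computable (tnth a i)) -> computable b ->
  semidecidable (fun e => f [tuple of [seq g e | g <- a]] (b e)).
Proof.
move=> rf ca cb.
apply: semidecidable_ext (semidecidable_graph_tuple (semidecidable_graph rf) ca cb) => e.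
suff -> : [tuple tnth a i e | i < n] = [tuple of [seq g e | g <- a]] by [].
by apply: eq_from_tnth => i; rewrite tnth_mktuple tnth_map.
Qed.

Lemma semidecidable_graph1 (f : pfun 1) a b : partial_recursive f ->
  computable a -> computable b -> semidecidable (fun e => f [tuple a e] (b e)).
Proof.
move=> rf ca cb; apply: semidecidable_ext (semidecidable_graph_map (a := [tuple a]) rf _ cb).
  by move=> e; rewrite (_ : [tuple of _] = [tuple a e]) //; apply: val_inj.
by move=> i; rewrite ord1.
Qed.

Lemma semidecidable_graph2 (f : pfun 2) a a' b : partial_recursive f ->
  computable a -> computable a' -> computable b ->
  semidecidable (fun e => f [tuple a e; a' e] (b e)).
Proof.
move=> rf ca ca' cb.
apply: semidecidable_ext (semidecidable_graph_map (a := [tuple a; a']) rf _ cb).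
  by move=> e; rewrite (_ : [tuple of _] = [tuple a e; a' e]) //; apply: val_inj.
by case=> [[|[|//]] ?]; rewrite (tnth_nth a).
Qed.

(** Post's argument: the searches for [P] and for [Q] run in parallel. At numbers that code no word,
    [P] and [Q] are arbitrary. *)
Lemma semidecidable_recursive_set k (A : set (freeGroup 'I_k)) (P Q : nat -> Prop) :
  semidecidable (fun e => P (e 0)) -> semidecidable (fun e => Q (e 0)) ->
  (forall w, P (word_code w) <-> A w) -> (forall w, Q (word_code w) <-> ~ A w) ->
  recursive_set A.
Proof.
move=> sP sQ PA QA.
have shift0 (S : nat -> Prop) : semidecidable (fun e => S (e 0)) ->
    semidecidable (fun e => S (e 1)).
  move=> sS; apply: (semidecidable_subst (s := fun i e => e i.+1) sS) => [i|m].
    exact: computable_var.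
  by exists m => e i me mi; apply: me; lia.
have [|f rf fG] := @semidecidable_uniformize 1
    (fun e => e 0 == 1 /\ P (e 1) \/ e 0 == 0 /\ Q (e 1)).
  by apply: semidecidable_or; apply: semidecidable_and (shift0 _ _) => //;
    apply/semidecidable_pred/computable_eqn; computable_vars.
exists f => // w; apply: fG => /=.
  by case: asboolP => [/PA|/QA]; [left|right].
move=> v [[/eqP-> /PA /asboolP->]//|[/eqP-> /QA nA]].
by case: asboolP.
Qed.

(** * Free group operations on codes *)

(** The last bit of a letter code is the sign of the letter, so inversion flips it. *)
Definition invl (a : nat) : nat := if odd a then a.-1 else a.+1.

Definition cred (a c : nat) : nat :=
  if (c != 0) && (hd c == invl a) then tl c else 2 ^ a * c.*2.+1.

(** A left fold meets the letters of [u] in the order in which [u^-1 * v] absorbs their inverses,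
    which makes left division the convenient group operation on codes. *)
Definition ldiv (c d : nat) : nat :=
  foldl (fun r a => cred (invl a) r) d (CodeSeq.decode c).

Lemma computable_odd a : computable a -> computable_pred (fun e => odd (a e)).
Proof.
move=> ca; have := computable_iteri (g := fun _ r _ => 1 - r) ca (computable_const 0)
  (computable_subn (computable_const 1) (computable_var 1)).
by apply: computable_ext => e; elim: (a e) => //= n ->; case: (odd n).
Qed.

Lemma computable_invl a : computable a -> computable (fun e => invl (a e)).
Proof.
move=> ca.
exact: computable_if (computable_odd ca) (computable_predn ca) (computable_succ ca).
Qed.

Lemma computable_ldiv a b : computable a -> computable b ->
  computable (fun e => ldiv (a e) (b e)).
Proof.
move=> ca cb; apply: computable_foldl => //.
have v0 := computable_var 0; have v1 := computable_invl (computable_var 1).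
apply: computable_if (computable_tl v0) (computable_ccons v1 v0).
apply: computable_and; first exact: computable_neg (computable_eqn v0 (computable_const 0)).
exact: computable_eqn (computable_hd v0) (computable_invl v1).
Qed.

Lemma letter_code_inv k (a : 'I_k * bool) : letter_code (inv_letter a) = invl (letter_code a).
Proof.
by case: a => i [] /=; rewrite /letter_code /invl /= oddD odd_double ?addn1 ?addn0.
Qed.

Lemma letter_code_inj k : injective (@letter_code k).
Proof.
move=> [i b] [j c] /= eq_ij; have eq_bc : b = c.
  by have := congr1 odd eq_ij; rewrite !oddD !odd_double !oddb.
move: eq_ij; rewrite /letter_code eq_bc => /addIn/double_inj/= eq_ij.
by congr pair; apply: val_inj.
Qed.

Lemma cred_code k (a : 'I_k * bool) w :
  cred (letter_code a) (CodeSeq.code (map (@letter_code k) w)) =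
  CodeSeq.code (map (@letter_code k) (cons_reduce a w)).
Proof.
case: w => [//|b w]; rewrite /cred -decode_eq0 /hd /tl CodeSeq.codeK /=.
rewrite -letter_code_inv (inj_eq (@letter_code_inj k)).
by case: ifP.
Qed.

Lemma ldiv_word_code k (u v : freeGroup 'I_k) :
  ldiv (word_code u) (word_code v) = word_code (u^-1 * v)%g.
Proof.
rewrite /ldiv /word_code CodeSeq.codeK /= /word_mul /word_inv.
rewrite -(foldl_rev (fun r a => cons_reduce a r)) revK; elim: (letters u) (letters v) => //= a w IHw v'.
by rewrite -letter_code_inv cred_code IHw.
Qed.

Lemma word_code_inj k : injective (@word_code k).
Proof.
by move=> u v /(can_inj CodeSeq.codeK)/(inj_map (@letter_code_inj k))/val_inj.
Qed.

Lemma csize_word_code k (w : freeGroup 'I_k) : csize (word_code w) = size (letters w).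
Proof. by rewrite /csize CodeSeq.codeK size_map. Qed.

(** The conditions on the right are decidable with bounded quantifiers; through them an algorithm
    recognises codes of reduced words. *)
Lemma word_codeP k c : (exists w : freeGroup 'I_k, c = word_code w) <->
  (forall i, i < csize c -> cnth c i < k.*2) /\
  (forall i, i < (csize c).-1 -> cnth c i.+1 != invl (cnth c i)).
Proof.
split=> [[w ->]|[lt_k red_c]].
  rewrite csize_word_code /cnth CodeSeq.codeK; split=> i iw; last first.
    have lt_i : i.+1 < size (letters w) by lia.
    have := letters_reduced w; rewrite /reduced.
    case Dw: (letters w) lt_i => [|a0 s] //= lt_i /(pathP a0)/(_ i lt_i).
    rewrite (nth_map a0) // -/(nth _ _ i.+1).
    rewrite -[letter_code a0 :: _]/(map (@letter_code k) (a0 :: s)) (nth_map a0); last by rewrite ltnW.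
    by rewrite -letter_code_inv (inj_eq (@letter_code_inj k)).
  case Dw: (letters w) iw => [|a0 s] // iw; rewrite (nth_map a0) //.
  case: (nth a0 _ i) => [[j jk] b]; rewrite /letter_code /=; case: b; lia.
have [s Ds] : exists s : seq ('I_k * bool), map (@letter_code k) s = CodeSeq.decode c.
  move: lt_k; rewrite /csize /cnth; elim: (CodeSeq.decode c) => [|a s IHs] lt_k.
    by exists [::].
  have [|s' Ds'] := IHs; first by move=> i; apply: (lt_k i.+1).
  have ak : a./2 < k by have := lt_k 0 isT; rewrite /=; lia.
  exists ((Ordinal ak, odd a) :: s'); rewrite /= Ds' /letter_code /=.
  by rewrite addnC odd_double_half.
have rs : reduced s.
  move: red_c; rewrite /csize /cnth -Ds size_map /reduced; case: (s) => //= a0 s' red_s.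
  apply/(pathP a0) => i lt_i; have := red_s i lt_i.
  rewrite (nth_map a0) // -[letter_code a0 :: _]/(map (@letter_code k) (a0 :: s')).
  rewrite (nth_map a0); last by rewrite ltnW.
  by rewrite -letter_code_inv (inj_eq (@letter_code_inj k)).
by exists (FreeWord rs); rewrite /word_code /= Ds CodeSeq.decodeK.
Qed.

Lemma semidecidable_word k a : computable a ->
  semidecidable (fun e => exists w : freeGroup 'I_k, a e = word_code w).
Proof.
move=> ca; have ca1 := computable_shift 1 ca.
suff s1 : semidecidable (fun e => (forall i, i < csize (a e) -> cnth (a e) i < k.*2) /\
    (forall i, i < (csize (a e)).-1 -> cnth (a e) i.+1 != invl (cnth (a e) i))).
  by apply: semidecidable_ext s1 => e; rewrite word_codeP.
apply: semidecidable_and.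
  apply: (semidecidable_bounded_all (P := fun i e => cnth (a e) i < k.*2)).
    exact: computable_csize.
  apply/semidecidable_pred/computable_leq; last exact: computable_const.
  exact: computable_succ (computable_cnth ca1 (computable_var 0)).
apply: (semidecidable_bounded_all (P := fun i e => cnth (a e) i.+1 != invl (cnth (a e) i))).
  exact: computable_predn (computable_csize ca).
apply/semidecidable_pred/computable_neg/computable_eqn.
  exact: computable_cnth ca1 (computable_succ (computable_var 0)).
exact: computable_invl (computable_cnth ca1 (computable_var 0)).
Qed.

(** * The Word Problem under change of question and of generators *)

Lemma fg_kernelE (G : groupType) k (x : 'I_k -> G) w :
  `[<fg_kernel x w>] = (free_lift x w == 1%g).
Proof. exact/asboolP/eqP. Qed.

(** Equality of [u] and [v] in the group is the Word Problem for [u^-1 * v], whose code [ldiv]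
    computes. *)
Lemma solvable_EP_setT (G : groupType) k (x : 'I_k -> G) :
  solvable_word_problem x -> solvable_EP_on x setT.
Proof.
case=> f0 rf0 f0P.
have [|f rf fG] := @semidecidable_uniformize 2 (fun e => f0 [tuple ldiv (e 1) (e 2)] (e 0)).
  apply: semidecidable_graph1 => //; last exact: computable_var.
  by apply: computable_ldiv; apply: computable_var.
have f0E u v : f0 [tuple ldiv (word_code u) (word_code v)] (free_lift x u == free_lift x v).
  have := f0P (u^-1 * v)%g; rewrite -ldiv_word_code fg_kernelE gmulfM gmulfV.
  by rewrite mulg_eq1 eqg_inv.
exists f => // u v _ _; apply: fG => [|v'] /=; first exact: f0E.
by move=> /(partial_recursive_functional rf0)-/(_ _ (f0E u v)).
Qed.

(** Each generator [x i] is spelled by a fixed word over [y]; substituting these words is computable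
    and reduces one kernel to the other. *)
Lemma solvable_word_problem_change (G : groupType) k k' (x : 'I_k -> G) (y : 'I_k' -> G) :
  generating y -> solvable_word_problem y -> solvable_word_problem x.
Proof.
move=> gy [f0 rf0 f0P].
have lift_x i : exists w, free_lift y w = x i.
  have : setT (x i) by [].
  by rewrite -(free_lift_surj gy) => -[w _ <-]; exists w.
pose X i := projT1 (cid (lift_x i)).
have XE i : free_lift y (X i) = x i by rewrite /X; case: cid.
have phiE w : free_lift y (free_lift X w) = free_lift x w.
  rewrite [free_lift X w]/free_lift gmulf_prod; apply: eq_bigr => -[i []] _;
  by rewrite /letter_val /= ?gmulfV /= XE.
(* The spellings of all [2k] letters form a finite table, a constant of the algorithm. *)
pose tab := CodeSeq.code (mkseq (fun a => if insub a./2 is Some i then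
  word_code (letter_val X (i, odd a)) else 0) k.*2).
(* Dividing by the successive spellings builds the inverse of the translated word, which lies in the
   kernel exactly when that word does. *)
pose T c := foldl (fun r a => ldiv (cnth tab a) r) 0 (CodeSeq.decode c).
have TE w : T (word_code w) = word_code (free_lift X w)^-1%g.
  suff TS s v : foldl (fun r a => ldiv (cnth tab a) r) (word_code v) (map (@letter_code k) s) =
      word_code ((\prod_(a <- s) letter_val X a)^-1 * v)%g.
    by rewrite /T /word_code CodeSeq.codeK (TS (letters w) 1%g) mulg1.
  elim: s v => [|a s IHs] v; first by rewrite big_nil invg1 mul1g.
  rewrite big_cons invgM -mulgA -IHs /=; congr foldl.
  have tabE : cnth tab (letter_code a) = word_code (letter_val X a).
    rewrite /cnth CodeSeq.codeK nth_mkseq; last first.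
      by case: a => [[i ik] b]; rewrite /letter_code /=; case: b; lia.
    case: a => i b; rewrite (_ : _./2 = i) ?valK.
      by rewrite /letter_code /= oddD odd_double oddb.
    by rewrite /letter_code /= addnC half_bit_double.
  by rewrite tabE ldiv_word_code.
have [|f rf fG] := @semidecidable_uniformize 1 (fun e => f0 [tuple T (e 1)] (e 0)).
  apply: semidecidable_graph1 => //; last exact: computable_var.
  apply: computable_foldl; try exact: computable_var; last exact: computable_const.
  apply: computable_ldiv; last exact: computable_var.
  exact: computable_cnth (computable_const tab) (computable_var 1).
have f0T w : f0 [tuple T (word_code w)] `[<fg_kernel x w>].
  by rewrite TE; have := f0P (free_lift X w)^-1%g; rewrite !fg_kernelE gmulfV /= phiE invg_eq1.
exists f => // w; apply: fG => /= [|v]; first exact: f0T.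
by move=> /(partial_recursive_functional rf0)-/(_ _ (f0T w)).
Qed.

(** * Counting reduced words *)

Definition successive (T : eqType) (a b : T * bool) : bool := b != inv_letter a.

(** Prescribing the letter [c] before the word makes the count the same power of [2k - 1] in every
    context, with no exceptional first letter. *)
Fixpoint words_after k (c : 'I_k * bool) n : seq (seq ('I_k * bool)) :=
  if n is m.+1 then
    [seq a :: v | a <- [seq a <- enum {: 'I_k * bool} | successive c a],
                  v <- words_after a m]
  else [:: [::]].

Lemma mem_words_after k (c : 'I_k * bool) n w :
  (w \in words_after c n) = (size w == n) && path (@successive _) c w.
Proof.
elim: n c w => [|n IHn] c w /=; first by rewrite inE; case: w.
apply/allpairsPdep/idP => [[a [v [+ + ->]]]|].
  by rewrite mem_filter IHn => /andP[/= -> _] /andP[/eqP-> ->]; rewrite eqxx.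
case: w => //= a v /andP[sz /andP[ca av]]; exists a, v; split=> //.
  by rewrite mem_filter ca mem_enum.
by rewrite IHn -eqSS sz.
Qed.

Lemma words_after_uniq k (c : 'I_k * bool) n : uniq (words_after c n).
Proof.
elim: n c => // n IHn c; apply: allpairs_uniq_dep => //.
  by rewrite filter_uniq ?enum_uniq.
by move=> [a v] [b w] _ _ /= [-> ->].
Qed.

Lemma size_words_after k (c : 'I_k * bool) n : size (words_after c n) = k.*2.-1 ^ n.
Proof.
elim: n c => // n IHn c; rewrite /= size_allpairs_dep.
rewrite sumnE big_map (eq_bigr (fun=> k.*2.-1 ^ n)) => [|a _]; last exact: IHn.
rewrite big_const_seq count_predT iter_addn_0 mulnC expnS; congr (_ * _).
rewrite -sum1_size big_filter big_enum_cond sum1dep_card (eq_card (B := predC1 (inv_letter c))).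
  by rewrite cardC1 card_prod card_ord card_bool muln2.
by move=> a; rewrite !inE.
Qed.

(** As in a Markov chain, only the last letter of the first part restricts the second. *)
Lemma sum_words_after_cat k (c : 'I_k * bool) m n (F : seq ('I_k * bool) -> nat) :
  \sum_(w <- words_after c (m + n)) F w =
  \sum_(u <- words_after c m) \sum_(v <- words_after (last c u) n) F (u ++ v).
Proof.
elim: m c F => [|m IHm] c F /=; first by rewrite big_seq1.
rewrite !big_allpairs_dep; apply: eq_bigr => a _.
exact: (IHm a (fun w => F (a :: w))).
Qed.

(** Two generators already give four letters, one more than are excluded. *)
Lemma avoid3 k (a1 a2 a3 : 'I_k * bool) : 1 < k ->
  exists a, [/\ a != a1, a != a2 & a != a3].
Proof.
move=> k1; case: (pickP [pred a | a \notin [:: a1; a2; a3]]) => [a /=|all3].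
  by rewrite !inE !negb_or => /and3P[]; exists a.
have: #|{: 'I_k * bool}| <= size [:: a1; a2; a3].
  apply: leq_trans (card_size _); apply/subset_leq_card/fintype.subsetP => a _.
  by have /negbT/= := all3 a; rewrite negbK.
by rewrite card_prod card_ord card_bool /=; lia.
Qed.

(** * Frequency of first hits *)

Section FirstHit.
Variables (k : nat) (p p0 : seq ('I_k * bool)).
Hypotheses (k_gt1 : 1 < k) (size_p0 : size p0 = size p).
Implicit Types (c a : 'I_k * bool) (u v w : seq ('I_k * bool)).

Let q := k.*2.-1.
Let L := (size p).+1.

(* A word is cut into blocks of length [size p + 1]; a block hits [p] if it is
   [p] preceded by one arbitrary letter. *)
Fixpoint first_hit N w : nat :=
  if N is N'.+1 then
    if behead (take L w) == p then 1 else
    if behead (take L w) == p0 then 2 else first_hit N' (drop L w)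
  else 0.

Definition hit_count N c i : nat := \sum_(w <- words_after c (L * N)) (first_hit N w == i).

Definition block_count c s : nat := \sum_(u <- words_after c L) (behead u == s).

(** Conditioning on the first block: after a hit the remaining blocks are free, otherwise the count
    starts anew behind the last letter of the block. *)
Lemma hit_countS N c i : hit_count N.+1 c i =
  \sum_(u <- words_after c L) (if behead u == p then (1 == i) * q ^ (L * N) else
    if behead u == p0 then (2 == i) * q ^ (L * N) else hit_count N (last c u) i).
Proof.
rewrite /hit_count mulnS sum_words_after_cat; apply: eq_big_seq => u.
rewrite mem_words_after => /andP[/eqP sz_u _].
have E v : first_hit N.+1 (u ++ v) = if behead u == p then 1 else
    if behead u == p0 then 2 else first_hit N v.
  by rewrite /= take_size_cat // drop_size_cat.
under eq_bigr => v _ do rewrite E.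
have const b : \sum_(v <- words_after (last c u) (L * N)) nat_of_bool b = b * q ^ (L * N).
  by rewrite big_const_seq count_predT iter_addn_0 size_words_after.
by case: ifP => _; [rewrite const | case: ifP => _; [rewrite const|]].
Qed.

Lemma hit_count_total N c : hit_count N c 0 + hit_count N c 1 + hit_count N c 2 = q ^ (L * N).
Proof.
rewrite -(size_words_after c) -!big_split -sum1_size; apply: eq_bigr => w _ /=.
by elim: N w => //= N IHN w; case: ifP => // _; case: ifP.
Qed.

(** Only the free letter [z] between [c] and [a] varies, so the count depends on the pattern through
    its first letter alone. Patterns that share it are equally frequent. *)
Lemma block_countE c a s : size s = (size p).-1 -> 0 < size p -> path (@successive _) a s ->
  block_count c (a :: s) =
  \sum_(z <- enum {: 'I_k * bool} | successive c z) successive z a.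
Proof.
move=> sz p_gt0 path_s.
rewrite /block_count [words_after c L]/= big_allpairs_dep big_filter; apply: eq_bigr => z _.
rewrite -(big_map (@id (seq ('I_k * bool))) xpredT (fun v => nat_of_bool (v == a :: s))) map_id.
rewrite -(big_mkcond (fun v => v == a :: s) (fun=> 1)) sum1_count.
rewrite -/(count_mem (a :: s) _) count_uniq_mem ?words_after_uniq // mem_words_after /= sz prednK //.
by rewrite eqxx path_s andbT.
Qed.

(** Whatever precedes a block, it shows either pattern equally often; hence each is equally often
    the first to occur. *)
Lemma hit_count_sym N c : p != p0 -> (forall c, block_count c p = block_count c p0) ->
  hit_count N c 1 = hit_count N c 2.
Proof.
move=> neq_p eq_block; elim: N c => [|N IHN] c.
  by rewrite /hit_count muln0 !big_seq1.
rewrite !hit_countS.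
(* The contribution of the blocks that show neither pattern, to which the induction applies. *)
pose rest u := if behead u == p then 0 else if behead u == p0 then 0 else hit_count N (last c u) 1.
transitivity (block_count c p * q ^ (L * N) + \sum_(u <- words_after c L) rest u).
  rewrite /block_count big_distrl -big_split; apply: eq_bigr => u _; rewrite /rest /=.
  by case: (eqVneq (behead u) p) => _; [rewrite addn0 | case: ifP].
rewrite eq_block /block_count big_distrl -big_split; apply: eq_bigr => u _; rewrite /rest /=.
case: (eqVneq (behead u) p) => [->|_]; first by rewrite (negbTE neq_p).
by case: ifP => // _; rewrite ?IHN // mul1n addn0.
Qed.

(** In any context at least one of the [q ^ L] possible blocks hits [p]. *)
Lemma hit_count0_le N c : (forall c, 0 < block_count c p) ->
  hit_count N c 0 <= (q ^ L).-1 ^ N.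
Proof.
move=> block_gt0; elim: N c => [|N IHN] c.
  by rewrite /hit_count muln0 !big_seq1.
rewrite hit_countS.
apply: (@leq_trans (\sum_(u <- words_after c L) (behead u != p) * (q ^ L).-1 ^ N)).
  apply: leq_sum => u _; case: (eqVneq (behead u) p) => //= _; rewrite mul1n; case: ifP => // _.
rewrite -big_distrl expnS leq_mul2r; apply/orP; right.
have: block_count c p + \sum_(u <- words_after c L) (behead u != p) = q ^ L.
  rewrite -big_split -(size_words_after c) -sum1_size; apply: eq_bigr => u _ /=.
  by case: (behead u == p).
move=> total; rewrite -[X in X <= _](addKn (block_count c p)) total -subn1.
by rewrite leq_sub2l.
Qed.

(** Bernoulli's inequality [(1 + 1/x)^m >= 1 + m/x] with denominators cleared. *)
Lemma bernoulli x m : x * x.+1 ^ m >= (x + m) * x ^ m.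
Proof.
elim: m => [|m IHm]; first by rewrite !expn0 !muln1 addn0.
rewrite !expnS [X in _ <= X]mulnCA; apply: leq_trans (leq_mul (leqnn x.+1) IHm).
by rewrite !mulnA; apply: leq_mul => //; nia.
Qed.

(** Bernoulli's inequality gives [(1 + 1/x)^x >= 2], and this is squared. *)
Lemma four_expn x m : 0 < x -> x.*2 <= m -> 4 * x ^ m <= x.+1 ^ m.
Proof.
move=> x_gt0 le_m; have two : 2 * x ^ x <= x.+1 ^ x.
  rewrite -(leq_pmul2l x_gt0); apply: leq_trans (bernoulli x x).
  by rewrite addnn -mul2n -mulnA mulnCA.
rewrite -(subnKC le_m) -addnn !expnD mulnA; apply: leq_mul.
  by have := leq_mul two two; rewrite mulnACA.
by case: (m - _) => // n; rewrite leq_exp2r.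
Qed.

(** By [four_expn] with [x = q ^ L - 1], at most a quarter of the words have no hit; the two
    patterns share the rest equally. *)
Lemma hit_count1_ge N c : p != p0 -> (forall c, block_count c p = block_count c p0) ->
  (forall c, 0 < block_count c p) -> (q ^ L).*2 <= N ->
  3 * q ^ (L * N) <= 8 * hit_count N c 1.
Proof.
move=> neq_p eq_block block_gt0 le_N.
have := hit_count_total N c; rewrite -(hit_count_sym N c neq_p eq_block).
have := hit_count0_le N c block_gt0.
have qL_gt1 : 1 < q ^ L.
  by rewrite expnS; have := expn_gt0 q (size p); rewrite /q; nia.
have := @four_expn (q ^ L).-1 N; rewrite prednK ?(ltnW qL_gt1) // -expnM; lia.
Qed.

End FirstHit.

(** * Exchanging patterns *)

(** For words whose [first_hit] is [1], the block changed here is the first one to show either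
    pattern. *)
Fixpoint replace_hit (T : eqType) (p p' : seq T) N w : seq T :=
  if N is N'.+1 then
    let L := (size p).+1 in
    if behead (take L w) == p then take 1 w ++ p' ++ drop L w
    else take L w ++ replace_hit p p' N' (drop L w)
  else w.

Lemma block_split (T : Type) l N (w : seq T) : size w = l.+1 * N.+1 ->
  exists z s v, [/\ w = z :: s ++ v, size s = l & size v = l.+1 * N].
Proof.
case: w => [|z w]; rewrite mulnS addSn // => -[sz_w].
exists z, (take l w), (drop l w); rewrite cat_take_drop size_takel ?sz_w ?leq_addr //.
by rewrite size_drop sz_w addKn.
Qed.

Lemma first_hit_block k (p p0 : seq ('I_k * bool)) N z s v : size s = size p ->
  first_hit p p0 N.+1 (z :: s ++ v) =
  if s == p then 1 else if s == p0 then 2 else first_hit p p0 N v.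
Proof. by move=> sz_s; rewrite /= take_size_cat // drop_size_cat. Qed.

Lemma replace_hit_block (T : eqType) (p p' : seq T) N z s v : size s = size p ->
  replace_hit p p' N.+1 (z :: s ++ v) =
  z :: if s == p then p' ++ v else s ++ replace_hit p p' N v.
Proof.
by move=> sz_s; rewrite /= take_size_cat // drop_size_cat // take0; case: ifP.
Qed.

Lemma replace_hitP k (p p0 p' : seq ('I_k * bool)) N w : size w = (size p).+1 * N ->
  first_hit p p0 N w = 1 -> exists U V, w = U ++ p ++ V /\ replace_hit p p' N w = U ++ p' ++ V.
Proof.
elim: N w => // N IHN w /block_split[z [s [v [-> sz_s sz_v]]]].
rewrite first_hit_block // replace_hit_block //; case: eqP => [->|_].
  by exists [:: z], v.
case: eqP => // _ /(IHN _ sz_v)[U [V [-> ->]]].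
by exists (z :: s ++ U), V; rewrite /= -!catA.
Qed.

(** The image shows [p0], the beginning of [p'], in the block of the exchange, and neither [p] nor
    [p0] in any earlier block. The place of the exchange can therefore be read off the image. *)
Lemma replace_hit_inj k (p p' : seq ('I_k * bool)) N w1 w2 :
  let p0 := take (size p) p' in size p <= size p' ->
  size w1 = (size p).+1 * N -> size w2 = (size p).+1 * N ->
  first_hit p p0 N w1 = 1 -> first_hit p p0 N w2 = 1 ->
  replace_hit p p' N w1 = replace_hit p p' N w2 -> w1 = w2.
Proof.
move=> p0 le_p; have take_p' s s' v : size s = size p -> p' ++ v = s ++ s' -> s = p0.
  move=> sz_s /(congr1 (take (size p))).
  by rewrite takel_cat // take_size_cat // => <-.
elim: N w1 w2 => // N IHN w1 w2 /block_split[z1 [s1 [v1 [-> sz_s1 sz_v1]]]].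
move=> /block_split[z2 [s2 [v2 [-> sz_s2 sz_v2]]]].
rewrite !first_hit_block // !replace_hit_block //.
case: (s1 =P p) => [->|_]; case: (s2 =P p) => [->|_].
- by move=> _ _ [-> /eqP]; rewrite eqseq_cat // eqxx => /eqP->.
- by case: eqP => // ne2 _ _ [_ /(take_p' _ _ _ sz_s2)/ne2].
- by case: eqP => // ne1 _ _ [_ /esym/(take_p' _ _ _ sz_s1)/ne1].
case: eqP => // _ hit1; case: eqP => // _ hit2 [-> /eqP].
by rewrite eqseq_cat ?sz_s1 // => /andP[/eqP-> /eqP/IHN->].
Qed.

(** Both patterns begin with [a] and end with the same letter, so their neighbours see no
    difference. *)
Lemma path_replace (T : eqType) (r : rel T) c a s s' U V : last a s = last a s' -> path r a s' ->
  path r c (U ++ (a :: s) ++ V) -> path r c (U ++ (a :: s') ++ V).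
Proof.
move=> eq_last path_s'; rewrite !cat_path /= -eq_last path_s'.
by case/and3P=> -> /andP[-> _] ->.
Qed.

(* In the free group [p' = w p] up to conjugation by the first letter [a], so
   exchanging [a p] and [a p'] inside a word multiplies it by a conjugate of
   [w]; splitting [w] in halves keeps the change of length bounded. *)
Lemma exchange_patterns k (w : seq ('I_k * bool)) : 1 < k -> reduced w -> w != [::] ->
  exists u v a b, let p := rcons (word_inv v) b in let p' := rcons u b in
  [/\ w = u ++ v, path (@successive _) a p, path (@successive _) a p',
      size p <= size p' <= (size p).+1 & a :: p != take (size p).+1 (a :: p')].
Proof.
move=> k_gt1 red_w w_neq0; set h := uphalf (size w).
have sz_w : 0 < size w by case: (w) w_neq0.
set u := take h w; set v := drop h w; set v' := word_inv v.
have sz_u : size u = h by rewrite size_takel // /h; lia.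
have sz_v' : size v' = size w - h by rewrite size_rev size_map size_drop.
have Dw : w = u ++ v by rewrite cat_take_drop.
have red_u : reduced u by apply: take_sorted.
have red_v' : reduced v' by apply/word_inv_reduced/drop_sorted.
have a0 : 'I_k * bool by case: (w) w_neq0.
have [a [a_u a_v' _]] := avoid3 (inv_letter (head a0 u)) (inv_letter (head a0 v')) a0 k_gt1.
(* The default [a] of [last] matters when a half is empty, as [b] then follows [a] directly. The
   third condition separates the patterns when the halves differ in length. *)
have [b [b_u b_v' b_u']] := avoid3 (inv_letter (last a u)) (inv_letter (last a v')) (last a u) k_gt1.
have path_a s : reduced s -> a != inv_letter (head a0 s) -> b != inv_letter (last a s) ->
    path (@successive _) a (rcons s b).
  move=> red_s a_s b_s; rewrite rcons_path {2}/successive b_s andbT.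
  case: s red_s a_s {b_s} => //= c s -> a_c; rewrite andbT /successive.
  by apply: contraNneq a_c => ->; rewrite inv_letterK.
exists u, v, a, b; split=> //; try exact: path_a.
  by rewrite !size_rcons sz_u -/v' sz_v' /h; lia.
rewrite -/v' size_rcons /= eqseq_cons eqxx /=.
(* For odd length, [u] is one letter longer than [v']: the compared words end in [b] and in the last
   letter of [u]. *)
have [odd_w|even_w] := boolP (odd (size w)).
  have -> : (size v').+1 = size u by rewrite sz_v' sz_u /h; lia.
  rewrite -cats1 -[rcons u b]cats1 take_size_cat //; apply: contraNneq b_u' => <-.
  by rewrite last_cat.
have sz_eq : size v' = size u by rewrite sz_v' sz_u /h; lia.
(* For equal halves, coinciding patterns would give [v = u^-1], and [w = u v] would cancel in the
   middle. *)
rewrite sz_eq take_oversize ?size_rcons //; apply/eqP => /rcons_inj[Dv'].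
have Dv : v = word_inv u by rewrite -Dv' /v' word_invK.
move: red_w; rewrite Dw Dv; case/lastP: (u) sz_u => [|s c _].
  by rewrite /h /=; lia.
rewrite /word_inv map_rcons rev_rcons cat_rcons /reduced => /cat_sorted2[_] /=.
by rewrite eqxx.
Qed.

Lemma hit_family k (w : seq ('I_k * bool)) n0 : 1 < k -> reduced w -> w != [::] ->
  exists n (W : seq (seq ('I_k * bool))) (f : seq ('I_k * bool) -> seq ('I_k * bool)),
  [/\ n0 <= n, 3 * k.*2.-1 ^ n <= 8 * k.*2.-1 * size W, uniq W, {in W &, injective f} &
    forall s, s \in W -> [/\ reduced s, size s <= n, reduced (f s), size (f s) <= n &
      exists u v A B, [/\ w = u ++ v, s = A ++ word_inv v ++ B & f s = A ++ u ++ B]]].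
Proof.
move=> k_gt1 red_w w_neq0.
have [u [v [a [b [Dw path_p path_p' sz_p neq_p]]]]] := exchange_patterns k_gt1 red_w w_neq0.
set p := rcons _ b in path_p sz_p neq_p; set p' := rcons u b in path_p' sz_p neq_p.
have /andP[le_p le_p'] := sz_p.
set p0 := take (size p).+1 (a :: p') in neq_p.
have Dp0 : p0 = a :: take (size p) p' by [].
have path_p0 : path (@successive _) a (take (size p) p') by apply: take_path.
have sz_p0 : size p0 = size (a :: p) by rewrite Dp0 /= size_takel.
have blockE c : block_count (a :: p) c (a :: p) = block_count (a :: p) c p0.
  by rewrite Dp0 !block_countE // size_takel.
have block_gt0 c : 0 < block_count (a :: p) c (a :: p).
  rewrite block_countE // lt0n sum_nat_seq_neq0; apply/hasP.
  have [z [z_c z_a _]] := avoid3 (inv_letter c) (inv_letter a) c k_gt1.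
  exists z; rewrite ?mem_enum // /successive z_c /=.
  rewrite eqb0 negbK; apply: contraNneq z_a => ->; by rewrite inv_letterK.
(* The first summand of [N] secures the proportion 3/8, the second a length of at least [n0]. *)
set L := (size (a :: p)).+1; set N := (k.*2.-1 ^ L).*2 + n0.
have big_N : (k.*2.-1 ^ L).*2 <= N by rewrite leq_addr.
have := hit_count1_ge k_gt1 sz_p0 a neq_p blockE block_gt0 big_N.
set W := [seq s <- words_after a (L * N) | first_hit (a :: p) p0 N s == 1].
have -> : hit_count (a :: p) p0 N a 1 = size W.
  by rewrite size_filter /hit_count -sum1_count [RHS]big_mkcond.
(* The exchange may add one letter, so the radius is [L * N + 1]; this costs the extra factor
   [2k - 1] in the bound on [size W]. *)
move=> le_W; exists (L * N).+1, W, (replace_hit (a :: p) (a :: p') N); split.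
- by rewrite /N; nia.
- by rewrite expnS mulnCA -mulnA [8 * _]mulnCA leq_mul2l le_W orbT.
- exact/filter_uniq/words_after_uniq.
- move=> s1 s2; rewrite !mem_filter !mem_words_after.
  move=> /and3P[/eqP hit1 /eqP sz1 _] /and3P[/eqP hit2 /eqP sz2 _].
  by apply: replace_hit_inj hit1 hit2.
move=> s; rewrite mem_filter mem_words_after => /and3P[/eqP hit /eqP sz path_s].
have [A [B [Ds Df]]] := replace_hitP (a :: p') sz hit.
have sz_f : size (replace_hit (a :: p) (a :: p') N s) <= (L * N).+1.
  move: (sz : size s = L * N); rewrite Df Ds !size_cat => <-.
  by rewrite -addnS leq_add2l -addSn leq_add2r.
split=> //; first exact: path_sorted path_s.
- by rewrite sz leqW.
- rewrite Df; apply: (@path_sorted _ _ a); rewrite Ds in path_s.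
  by apply: path_replace path_s => //; rewrite !last_rcons.
exists u, v, (rcons A a), (b :: B); split=> //.
  by rewrite Ds /p /= !cat_rcons.
by rewrite Df /p' /= !cat_rcons.
Qed.

(** * Balls and generic sets *)

Definition fg_ball_card k n : nat := #|` fset_set (@fg_ball k n)|.

Lemma fg_ball_card_ge k n (l : seq (freeGroup 'I_k)) : uniq l ->
  (forall w, w \in l -> size (letters w) <= n) -> size l <= fg_ball_card k n.
Proof.
move=> uniq_l l_n; rewrite /fg_ball_card; apply: uniq_leq_size => // w /l_n w_n.
by rewrite in_fset_set ?inE //; apply: finite_fg_ball.
Qed.

(** In the ball the listed words are disjoint from [S], so their proportion is at most one minus
    that of [S], hence below [1 / (M + 1)] beyond a threshold that does not depend on the list. *)
Lemma generic_small_complement k (S : set (freeGroup 'I_k)) M : generic S ->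
  exists n0, forall n (l : seq (freeGroup 'I_k)), n0 <= n -> uniq l ->
    (forall w, w \in l -> size (letters w) <= n /\ ~ S w) -> M * size l <= fg_ball_card k n.
Proof.
move=> gS; have M_gt0 : (0 < M.+1%:R^-1 :> rat)%R by rewrite invr_gt0 ltr0n.
have /(_ _ _ M_gt0)[n0 _ near_n0] := (cvgrPdist_lt _ _).1 gS.
exists n0 => n l n0n uniq_l l_n; have := near_n0 n n0n; rewrite /=.
rewrite -/(fg_ball_card k n); set s := #|` _|; set b := fg_ball_card k n.
have fin_B := @finite_fg_ball k n.
have le_b : size l + s <= b.
  rewrite /s -size_cat; apply: fg_ball_card_ge => [|w].
    rewrite cat_uniq uniq_l fset_uniq andbT /=; apply/hasPn => w.
    rewrite in_fset_set ?inE; last exact: finite_setIr.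
    by case=> Sw _; apply/negP => /l_n[].
  rewrite mem_cat => /orP[/l_n[]//|].
  by rewrite in_fset_set ?inE; [case | exact: finite_setIr].
have b_gt0 : 0 < b.
  by apply: (@fg_ball_card_ge k n [:: 1%g]) => // w; rewrite inE => /eqP->.
move=> /(le_lt_trans (ler_norm _)).
have le_s : s <= b by apply: leq_trans le_b; apply: leq_addl.
clearbody s b; have bR_gt0 : (0 < b%:R :> rat)%R by rewrite ltr0n.
rewrite -(ltr_pM2r bR_gt0) mulrBl mulfVK ?gt_eqF // mul1r ltr_pdivlMl ?ltr0n //.
rewrite -natrB //.
rewrite -natrM ltr_nat => lt_b.
apply: leq_trans (ltnW lt_b); apply: leq_mul; first exact: leqnSn.
by rewrite -(leq_add2r s) subnK.
Qed.

Fixpoint ball_words k n : seq (seq ('I_k * bool)) :=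
  if n is m.+1 then
    ball_words k m ++ [seq a :: v | a <- enum {: 'I_k * bool}, v <- words_after a m]
  else [:: [::]].

Lemma mem_ball_words k n (w : seq ('I_k * bool)) : reduced w -> size w <= n -> w \in ball_words k n.
Proof.
move=> red_w; elim: n => [|n IHn] /=; first by case: w {red_w}.
rewrite leq_eqVlt mem_cat => /orP[/eqP|/IHn->//].
case: w red_w {IHn} => //= a w path_w [sz]; apply/orP; right.
by apply/allpairsPdep; exists a, w; rewrite mem_enum mem_words_after sz eqxx.
Qed.

(** The new sphere has at most as many words as the bound for the previous ball, and doubling that
    bound costs less than a factor [2k - 1 >= 3]. *)
Lemma size_ball_words k n : 1 < k -> size (ball_words k n) <= k.*2 * k.*2.-1 ^ n.
Proof.
move=> k_gt1; elim: n => [|n IHn] /=; first by lia.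
rewrite size_cat size_allpairs_dep sumnE big_map.
rewrite (eq_bigr (fun=> k.*2.-1 ^ n)) => [|a _]; last exact: size_words_after.
rewrite big_const_seq count_predT iter_addn_0 -cardE card_prod card_ord card_bool muln2.
rewrite [_ ^ n * _]mulnC; apply: leq_trans (leq_add IHn (leqnn _)) _.
by rewrite addnn -muln2 -mulnA leq_mul2l expnSr leq_mul2l; lia.
Qed.

Lemma fg_ball_card_le k n : 1 < k -> fg_ball_card k n <= k.*2 * k.*2.-1 ^ n.
Proof.
move=> k_gt1; apply: leq_trans (size_ball_words n k_gt1).
rewrite /fg_ball_card -(size_map (@letters 'I_k)); apply: uniq_leq_size.
  by rewrite map_inj_uniq ?fset_uniq //; apply: val_inj.
move=> _ /mapP[w + ->]; rewrite in_fset_set ?inE; last exact: finite_fg_ball.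
by apply: mem_ball_words; apply: letters_reduced.
Qed.

(** * Votes on the tested word *)

(** Unlike [FreeWord], this accepts words that are not reduced, so products can be computed piece by
    piece. *)
Definition word_eval k (s : seq ('I_k * bool)) : freeGroup 'I_k :=
  (\prod_(a <- s) letter_val (@fg_gen _) a)%g.

Lemma word_eval_cat k (s t : seq ('I_k * bool)) :
  word_eval (s ++ t) = (word_eval s * word_eval t)%g.
Proof. exact: big_cat. Qed.

Lemma word_eval_inv k (s : seq ('I_k * bool)) : word_eval (word_inv s) = (word_eval s)^-1%g.
Proof.
elim: s => [|a s IHs]; first by rewrite /word_eval big_nil invg1.
rewrite /word_inv /= rev_cons -cats1 word_eval_cat IHs /word_eval big_seq1 big_cons invgM.
by rewrite letter_val_inv.
Qed.

Lemma word_eval_letters k (w : freeGroup 'I_k) : word_eval (letters w) = w.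
Proof.
have idE := @free_lift_unique _ _ (@fg_gen 'I_k)
  [the {multiplicative freeGroup 'I_k -> freeGroup 'I_k} of idfun] (fun=> erefl).
exact/esym/(idE w).
Qed.

Lemma letters_word_eval k (s : seq ('I_k * bool)) : reduced s -> letters (word_eval s) = s.
Proof. by move=> rs; rewrite -[s]/(letters (FreeWord rs)) word_eval_letters. Qed.

Lemma decode_words k c : (forall i, i < csize c -> exists w : freeGroup 'I_k, cnth c i = word_code w) ->
  exists W : seq (freeGroup 'I_k), CodeSeq.decode c = map (@word_code k) W.
Proof.
rewrite /csize /cnth; elim: (CodeSeq.decode c) => [|a s IHs] Wc; first by exists [::].
have [w /= ->] := Wc 0 isT.
by have [i|W ->] := IHs; [apply: (Wc i.+1) | exists (w :: W)].
Qed.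

Lemma computable_uniq a : computable a ->
  computable_pred (fun e => uniq (CodeSeq.decode (a e))).
Proof.
move=> ca; have ca2 := computable_shift 2 ca.
have cu : computable_pred (fun e => all (fun i => all (fun j =>
    cnth (a e) j != cnth (a e) i) (iota 0 i)) (iota 0 (csize (a e)))).
  apply: (computable_all (P := fun i e => all (fun j => cnth (a e) j != cnth (a e) i) (iota 0 i))).
    exact: computable_csize.
  apply: (computable_all (P := fun j e => cnth (a (fun i => e i.+1)) j != cnth (a (fun i => e i.+1)) (e 0))).
    exact: computable_var.
  apply/computable_neg/computable_eqn; first exact: computable_cnth ca2 (computable_var 0).
  exact: computable_cnth ca2 (computable_var 1).
apply: computable_ext cu => e; congr nat_of_bool; rewrite /csize /cnth.
set s := CodeSeq.decode _; apply/allP/(uniqP 0) => [neq_s i j|inj_s i].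
  have lt_neq i' j' : j' < size s -> i' < j' -> nth 0 s i' <> nth 0 s j'.
    move=> js ij; have /allP/(_ i') : all (fun l => nth 0 s l != nth 0 s j') (iota 0 j').
      by apply: neq_s; rewrite mem_iota.
    by rewrite mem_iota => /(_ ij)/eqP.
  rewrite !inE => si sj eq_ij; case: (ltngtP i j) => // [ij|ji].
    by case: (lt_neq _ _ sj ij).
  by case: (lt_neq _ _ si ji).
rewrite mem_iota /= add0n => si; apply/allP => j; rewrite mem_iota /= add0n => ji.
by rewrite (inj_in_eq inj_s) ?inE ?(ltn_trans ji) // ltn_eqF.
Qed.

(* [c] codes the tested word; the lists coded by [l] and [l'] pair words of length
   at most [n] that differ by a conjugate of it. *)
Definition vote k (f : pfun 2) n0 (b c n l l' : nat) : Prop :=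
  [&& n0 <= n, csize l == csize l', k.*2.-1 ^ n <= 4 * k.*2.-1 * csize l,
      uniq (CodeSeq.decode l) & uniq (CodeSeq.decode l')] /\
  forall i, i < csize l ->
    ((exists u : freeGroup 'I_k, cnth l i = word_code u) /\
     (exists u : freeGroup 'I_k, cnth l' i = word_code u)) /\
    (((csize (cnth l i) <= n) && (csize (cnth l' i) <= n) /\
      f [tuple cnth l i; cnth l' i] b) /\
     (exists h, (exists u : freeGroup 'I_k, h = word_code u) /\
       ldiv c (ldiv h (cnth l' i)) == ldiv h (cnth l i))).

Lemma semidecidable_vote k f n0 b : partial_recursive f ->
  semidecidable (fun e => exists n l l', @vote k f n0 b (e 0) n l l').
Proof.
(* The quantified values are pushed in front of the environment: [l'], [l], [n] and [c] become
   variables [0] to [3]. *)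
move=> rf; apply: semidecidable_ex; apply: semidecidable_ex; apply: semidecidable_ex.
have cexp a c : computable a -> computable (fun e => c ^ a e).
  exact: computable_expn (computable_const c).
apply: semidecidable_and.
  apply: semidecidable_pred; do ! apply: computable_and.
  - exact: computable_leq (computable_const _) (computable_var 2).
  - exact: computable_eqn (computable_csize (computable_var 1)) (computable_csize (computable_var 0)).
  - apply: computable_leq; first exact/cexp/computable_var.
    exact: computable_muln (computable_const _) (computable_csize (computable_var 1)).
  - exact: computable_uniq (computable_var 1).
  - exact: computable_uniq (computable_var 0).
apply: (semidecidable_bounded_all (P := fun i e =>
    ((exists u : freeGroup 'I_k, cnth (e 1) i = word_code u) /\
     (exists u : freeGroup 'I_k, cnth (e 0) i = word_code u)) /\
    (((csize (cnth (e 1) i) <= e 2) && (csize (cnth (e 0) i) <= e 2) /\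
      f [tuple cnth (e 1) i; cnth (e 0) i] b) /\
     (exists h, (exists u : freeGroup 'I_k, h = word_code u) /\
       ldiv (e 3) (ldiv h (cnth (e 0) i)) == ldiv h (cnth (e 1) i))))).
  exact: computable_csize (computable_var 1).
have cl := computable_cnth (computable_var 2) (computable_var 0).
have cl' := computable_cnth (computable_var 1) (computable_var 0).
apply: semidecidable_and; [apply: semidecidable_and|apply: semidecidable_and].
- exact: semidecidable_word.
- exact: semidecidable_word.
- apply: semidecidable_and.
    apply/semidecidable_pred/computable_and.
      exact: computable_leq (computable_csize cl) (computable_var 3).
    exact: computable_leq (computable_csize cl') (computable_var 3).
  exact: semidecidable_graph2 (computable_const b).
apply: (semidecidable_ex (P := fun h e => (exists u : freeGroup 'I_k, h = word_code u) /\
       ldiv (e 4) (ldiv h (cnth (e 1) (e 0))) == ldiv h (cnth (e 2) (e 0)))).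
apply: semidecidable_and; first exact/semidecidable_word/computable_var.
have v0 := computable_var 0; have v1 := computable_var 1.
apply/semidecidable_pred/computable_eqn.
  apply: computable_ldiv (computable_var 5) (computable_ldiv v0 _).
  exact: computable_cnth (computable_var 2) v1.
exact: computable_ldiv v0 (computable_cnth (computable_var 3) v1).
Qed.

Lemma count_or_le (T : Type) (a b : pred T) s : all (predU a b) s ->
  size s <= count a s + count b s.
Proof. by move=> abs; rewrite -count_predUI (eqP (_ : count _ s == size s)) ?leq_addr // -all_count. Qed.

(** With [q = 2k - 1], at least [q^n / (4q)] pairs vote, while each list has at most [q^n / (16q)]
    members outside [S]. Some pair thus lies in [S x S], where the answer of [f] is correct. *)
Lemma vote_sound (G : groupType) k (y : 'I_k -> G) (S : set (freeGroup 'I_k)) (f : pfun 2) n0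
    (b : bool) w n l l' :
  (forall n (W : seq (freeGroup 'I_k)), n0 <= n -> uniq W ->
    (forall w, w \in W -> size (letters w) <= n /\ ~ S w) ->
    16 * k.*2.-1 * size W <= k.*2.-1 ^ n) ->
  1 < k -> partial_recursive f ->
  (forall u v, S u -> S v -> f [tuple word_code u; word_code v] (free_lift y u == free_lift y v)) ->
  @vote k f n0 b (word_code w) n l l' -> b = (free_lift y w == 1%g).
Proof.
move=> bad_le k_gt1 rf fS [/and5P[n0n /eqP sz_l le_n uniq_l uniq_l'] ll'].
have [W DW] : exists W : seq (freeGroup 'I_k), CodeSeq.decode l = map (@word_code k) W.
  by apply: decode_words => i /ll'[[]].
have [W' DW'] : exists W : seq (freeGroup 'I_k), CodeSeq.decode l' = map (@word_code k) W.
  by apply: decode_words => i; rewrite -sz_l => /ll'[[]].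
have sz_W : csize l = size W by rewrite /csize DW size_map.
have sz_W' : size W' = size W by rewrite -sz_W sz_l /csize DW' size_map.
have lE i : i < size W -> cnth l i = word_code (nth 1%g W i).
  by move=> iW; rewrite /cnth DW (nth_map 1%g).
have l'E i : i < size W -> cnth l' i = word_code (nth 1%g W' i).
  by move=> iW; rewrite /cnth DW' (nth_map 1%g) ?sz_W'.
rewrite DW (map_inj_uniq (@word_code_inj k)) in uniq_l.
rewrite DW' (map_inj_uniq (@word_code_inj k)) in uniq_l'.
rewrite sz_W in ll' le_n.
have few_bad V : uniq V -> (forall v, v \in V -> size (letters v) <= n) ->
    16 * k.*2.-1 * count (fun v => ~~ `[< S v >]) V <= k.*2.-1 ^ n.
  move=> uniq_V V_n; rewrite -size_filter; apply: bad_le; rewrite ?filter_uniq // => v.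
  by rewrite mem_filter => /andP[/asboolPn Sv /V_n].
have W_n v : v \in W -> size (letters v) <= n.
  move=> /(nthP 1%g)[i iW <-]; have [_ [[/andP[]]]] := ll' i iW.
  by rewrite lE // csize_word_code.
have W'_n v : v \in W' -> size (letters v) <= n.
  move=> /(nthP 1%g)[i]; rewrite sz_W' => iW <-; have [_ [[/andP[_]]]] := ll' i iW.
  by rewrite l'E // csize_word_code.
have /hasP[[u u']] : has (fun uv => `[< S uv.1 >] && `[< S uv.2 >]) (zip W W').
  apply: contraTT isT => no_good.
  have : size (zip W W') <= count (fun v => ~~ `[< S v >]) W + count (fun v => ~~ `[< S v >]) W'.
    rewrite -{2}(@unzip1_zip _ _ W W') ?sz_W' // -{3}(@unzip2_zip _ _ W W') ?sz_W' //.
    rewrite !count_map; apply: count_or_le; rewrite -all_predC in no_good.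
    by apply: sub_all no_good => uv /=; rewrite negb_and.
  rewrite size_zip sz_W' minnn; have := few_bad W uniq_l W_n; have := few_bad W' uniq_l' W'_n.
  have : 0 < k.*2.-1 ^ n by rewrite expn_gt0; lia.
  move: (count _ W) (count _ W') => c c'; nia.
move=> /(nthP (1%g, 1%g))[i]; rewrite size_zip sz_W' minnn => iW.
rewrite nth_zip ?sz_W' // => -[<- <-] /andP[/asboolP Su /asboolP Su'].
have [_ [[_ fb] [h [[v ->]]]]] := ll' i iW.
rewrite lE // l'E // !ldiv_word_code (inj_eq (@word_code_inj k)) in fb * => /eqP eq_conj.
have := partial_recursive_functional rf fb (fS _ _ Su Su').
move=> /(congr1 (fun m => m == 1)); rewrite !eqb1 => ->.
have := congr1 (free_lift y) eq_conj; rewrite !gmulfM !gmulfV /= => {}eq_conj.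
(* In the group [v^-1 u = w^-1 v^-1 u'], so the members of the pair agree exactly when [w] is
   trivial. *)
rewrite -(inj_eq (mulgI (free_lift y v)^-1%g)) -eq_conj.
apply/eqP/eqP => [/(canRL (mulgK _))|->]; last by rewrite invg1 mul1g.
by rewrite mulgV => /eqP; rewrite invg_eq1 => /eqP.
Qed.

(** Of the [3 q^n / (8q)] pairs given by [hit_family], where [q = 2k - 1], at most [2 q^n / (16q)]
    have a member outside [S]; the remaining [q^n / (4q)] reach the quorum. *)
Lemma vote_complete (G : groupType) k (y : 'I_k -> G) (S : set (freeGroup 'I_k)) (f : pfun 2) n0 w :
  (forall n (W : seq (freeGroup 'I_k)), n0 <= n -> uniq W ->
    (forall w, w \in W -> size (letters w) <= n /\ ~ S w) ->
    16 * k.*2.-1 * size W <= k.*2.-1 ^ n) ->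
  1 < k -> w != 1%g ->
  (forall u v, S u -> S v -> f [tuple word_code u; word_code v] (free_lift y u == free_lift y v)) ->
  exists n l l', @vote k f n0 (free_lift y w == 1%g) (word_code w) n l l'.
Proof.
move=> bad_le k_gt1 w_neq1 fS.
have w_neq0 : letters w != [::] by [].
have [n [W [g [n0n le_W uniq_W inj_g gP]]]] := hit_family n0 k_gt1 (letters_reduced w) w_neq0.
have evalK (s : seq ('I_k * bool)) : reduced s -> letters (word_eval s) = s.
  exact: letters_word_eval.
have inj_ev : {in W &, injective (@word_eval k)}.
  by move=> s t /gP[rs _ _ _ _] /gP[rt _ _ _ _] /(congr1 (@letters _)); rewrite !evalK.
have inj_evg : {in W &, injective (@word_eval k \o g)}.
  move=> s t sW tW; have [_ _ rs _ _] := gP s sW; have [_ _ rt _ _] := gP t tW.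
  by move/(congr1 (@letters _)); rewrite /= !evalK // => /inj_g; apply.
(* By injectivity a bound on bad words bounds the bad pairs; this is applied to the first and to the
   second members. *)
have few_bad (h : seq ('I_k * bool) -> freeGroup 'I_k) : {in W &, injective h} ->
    (forall s, s \in W -> size (letters (h s)) <= n) ->
    16 * k.*2.-1 * count (fun s => ~~ `[< S (h s) >]) W <= k.*2.-1 ^ n.
  move=> inj_h h_n; rewrite -size_filter -(size_map h); apply: bad_le => // [|v].
    rewrite map_inj_in_uniq ?filter_uniq // => s t; rewrite !mem_filter.
    by move=> /andP[_ sW] /andP[_ tW]; apply: inj_h.
  case/mapP => s; rewrite mem_filter => /andP[/asboolPn Ss sW] ->.
  by split; first exact: h_n.
pose good s := `[< S (word_eval s) >] && `[< S (word_eval (g s)) >].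
set V := [seq s <- W | good s].
have V_W s : s \in V -> s \in W by rewrite mem_filter => /andP[].
have le_V : k.*2.-1 ^ n <= 4 * k.*2.-1 * size V.
  have := few_bad _ inj_ev; have := few_bad _ inj_evg; rewrite size_filter.
  have : size W <= count good W + (count (fun s => ~~ `[< S (word_eval s) >]) W +
      count (fun s => ~~ `[< S ((@word_eval k \o g) s) >]) W).
    rewrite -(count_predC good) leq_add2l -(size_filter (predC good)).
    apply: leq_trans (count_or_le (a := fun s => ~~ `[< S (word_eval s) >])
      (b := fun s => ~~ `[< S ((@word_eval k \o g) s) >]) _) _.
      by apply/allP => s; rewrite mem_filter /= /good negb_and => /andP[].
    by rewrite !count_filter; apply: leq_add; apply: sub_count => s /andP[].
  move: (count _ W) (count _ W) (count _ W) => c0 c1 c2 le_c.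
  have e1 s : s \in W -> size (letters (word_eval s)) <= n.
    by case/gP => rs sn _ _ _; rewrite evalK.
  have e2 s : s \in W -> size (letters ((@word_eval k \o g) s)) <= n.
    by case/gP => _ _ rs sn _; rewrite /= evalK.
  by move=> /(_ e2) + /(_ e1); nia.
have uniq_codes (h : seq ('I_k * bool) -> freeGroup 'I_k) : {in W &, injective h} ->
    uniq (map (@word_code k \o h) V).
  move=> inj_h; rewrite map_inj_in_uniq ?filter_uniq // => s t /V_W sW /V_W tW.
  by move/word_code_inj; apply: inj_h.
exists n, (CodeSeq.code (map (@word_code k \o @word_eval k) V)),
  (CodeSeq.code (map (@word_code k \o (@word_eval k \o g)) V)).
rewrite /vote /csize /cnth !CodeSeq.codeK !size_map eqxx n0n le_V; split=> [|i iV].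
  by rewrite !uniq_codes.
set s := nth [::] V i; have sV : s \in V by apply: mem_nth.
have -> : nth 0 (map (@word_code k \o @word_eval k) V) i = word_code (word_eval s).
  by rewrite (nth_map [::]).
have -> : nth 0 (map (@word_code k \o (@word_eval k \o g)) V) i = word_code (word_eval (g s)).
  by rewrite (nth_map [::]).
have [rs sn rgs gsn [u [v [A [B [Dw Ds Dgs]]]]]] := gP s (V_W s sV).
split; first by split; eexists.
rewrite -!/(csize _) !csize_word_code !evalK // sn gsn; split.
  split=> //; move: sV; rewrite mem_filter => /andP[/andP[/asboolP Ss /asboolP Sgs] _].
  have := fS _ _ Ss Sgs; congr (f _ (nat_of_bool _)).
  rewrite Dgs Ds -(word_eval_letters w) Dw !word_eval_cat word_eval_inv !gmulfM gmulfV /=.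
  rewrite (inj_eq (mulgI _)) (inj_eq (mulIg _)) eq_sym -divg_eq1 /=.
  by rewrite invgK.
(* Without the common prefix [A] the pair reads [v^-1 B] and [u B], and [w^-1 u B = v^-1 B]. *)
exists (word_code (word_eval A)); split; first by eexists.
rewrite !ldiv_word_code (inj_eq (@word_code_inj k)) -(word_eval_letters w) Dw Dgs Ds.
by rewrite !word_eval_cat !mulKg word_eval_inv invgM -mulgA mulKg.
Qed.

Lemma generic_EP_word_problem (G : groupType) k (y : 'I_k -> G) (S : set (freeGroup 'I_k)) :
  1 < k -> generic S -> solvable_EP_on y S -> solvable_word_problem y.
Proof.
move=> k_gt1 gS [f rf fS].
(* The factor [2k] makes up for the bound [2k (2k - 1)^n] on the size of the ball. *)
have [n0 bad_le] := generic_small_complement (k.*2 * (16 * k.*2.-1)) gS.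
have {}bad_le n (W : seq (freeGroup 'I_k)) : n0 <= n -> uniq W ->
    (forall w, w \in W -> size (letters w) <= n /\ ~ S w) ->
    16 * k.*2.-1 * size W <= k.*2.-1 ^ n.
  move=> n0n uniq_W W_n; have k2_gt0 : 0 < k.*2 by lia.
  rewrite -(leq_pmul2l k2_gt0) mulnA; apply: leq_trans (bad_le n W n0n uniq_W W_n) _.
  exact: fg_ball_card_le.
have sound b w n l l' := @vote_sound G k y S f n0 b w n l l' bad_le k_gt1 rf fS.
(* The empty word, with code [0], yields no exchange and is accepted separately. *)
apply: (semidecidable_recursive_set
  (P := fun c => c == 0 \/ exists n l l', @vote k f n0 1 c n l l')
  (Q := fun c => exists n l l', @vote k f n0 0 c n l l')).
- apply: semidecidable_or; last exact: semidecidable_vote.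
  exact/semidecidable_pred/(computable_eqn (computable_var 0))/computable_const.
- exact: semidecidable_vote.
- move=> w; rewrite (_ : fg_kernel y w <-> free_lift y w == 1%g); last by split=> /eqP.
  split=> [[w0|[n [l [l' /(sound true)<-]]]]//|w1].
    by rewrite (word_code_inj (eqP w0 : _ = word_code 1%g)) gmulf1.
  have [->|w_neq1] := eqVneq w 1%g; first by left.
  by right; have := vote_complete bad_le k_gt1 w_neq1 fS; rewrite w1.
- move=> w; rewrite (_ : fg_kernel y w <-> free_lift y w == 1%g); last by split=> /eqP.
  split=> [[n [l [l' /(sound false)<-]]]//|/negP w1].
  have w_neq1 : w != 1%g by apply: contraNneq w1 => ->; rewrite gmulf1.
  by have := vote_complete bad_le k_gt1 w_neq1 fS; rewrite (negbTE w1).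
Qed.

(** * Groups with at most one generator *)

(** An element of infinite order gets [d = 0], which divides only [0]. *)
Lemma order_exists (G : groupType) (g : G) : exists d, forall n, (g ^+ n == 1)%g = (d %| n).
Proof.
have [ex_n|no_n] := pselect (exists n, (0 < n) && (g ^+ n == 1)%g); last first.
  exists 0 => n; rewrite dvd0n; case: posnP => [->|n_gt0]; first by rewrite expg0 eqxx.
  by apply/negP => gn; apply: no_n; exists n; rewrite n_gt0.
case: (ex_minnP ex_n) => d /andP[d_gt0 /eqP gd] min_d.
exists d => n; rewrite {1}(divn_eq n d) expgnDr mulnC expgnA gd expg1n mul1g /dvdn.
case: posnP => [->|r_gt0]; first by rewrite expg0 eqxx.
apply/negP => gr; have := min_d (n %% d); rewrite r_gt0 gr => /(_ isT).
by rewrite leqNgt ltn_pmod.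
Qed.

(** A reduced word in at most one generator is a power of a letter. It is trivial exactly when the
    order [d], a constant of the algorithm, divides its length. *)
Lemma cyclic_word_problem (G : groupType) k (y : 'I_k -> G) : k <= 1 -> solvable_word_problem y.
Proof.
move=> k_le1; have eq_k (i j : 'I_k) : i = j.
  by apply: val_inj; case: i j => [[|i] ?] [[|j] ?] //=; lia.
have [d dP] : exists d, forall w, (free_lift y w == 1)%g = (d %| size (letters w)).
  have [i0|no_i] := pselect (exists i : 'I_k, True); last first.
    exists 0 => w; have -> : w = 1%g; last by rewrite gmulf1 eqxx.
    by apply: val_inj; case: w => -[|[i b] s] red_w //; case: no_i; exists i.
  have [i _] := i0; have [d dP] := order_exists (y i); exists d => w.
  rewrite -dP; have [b Dw] : exists b, letters w = nseq (size (letters w)) (i, b).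
    have := letters_reduced w; rewrite /reduced; case: (letters w) => [|[j b] s] /=.
      by exists true.
    rewrite (eq_k j i) => path_s; exists b; congr cons; apply/all_pred1P.
    elim: s path_s => //= -[j' b'] s IHs; rewrite (eq_k j' i) /inv_letter /= !xpair_eqE eqxx /=.
    by case: b b' IHs => [] [] //= IHs /IHs->; rewrite eqxx.
  rewrite {1}/free_lift Dw big_nseq size_nseq.
  have iterE m (h : G) : (iter m ( *%g h) 1 = h ^+ m)%g by elim: m => // m IHm; rewrite iterS IHm expgS.
  rewrite iterE; case: b {Dw} => //.
  by rewrite /letter_val /= expVgn invg_eq1.
have cP : computable_pred (fun e => has (fun q => csize (e 0) == q * d) (iota 0 (csize (e 0)).+1)).
  apply: (computable_has (P := fun q e => csize (e 0) == q * d)).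
    exact/computable_succ/computable_csize/computable_var.
  apply: computable_eqn; first exact/computable_csize/computable_var.
  exact: computable_muln (computable_var 0) (computable_const d).
have hasE c : has (fun q => csize c == q * d) (iota 0 (csize c).+1) = (d %| csize c).
  apply/hasP/dvdnP => [[q _ /eqP]|[q Dc]]; first by exists q.
  (* For [d = 0] the given quotient may exceed the bound of the search, and [0] replaces it. *)
  have [d0|d_gt0] := posnP d.
    by exists 0; rewrite // Dc d0 muln0.
  exists q; last exact/eqP.
  by rewrite mem_iota /= add0n ltnS Dc leq_pmulr.
apply: (semidecidable_recursive_set (P := fun c => d %| csize c) (Q := fun c => ~~ (d %| csize c))).
- by apply: semidecidable_ext (semidecidable_pred cP) => e; rewrite hasE.
- by apply: semidecidable_ext (semidecidable_pred (computable_neg cP)) => e; rewrite hasE.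
- by move=> w; rewrite csize_word_code -dP; split=> /eqP.
- by move=> w; rewrite csize_word_code -dP; split=> [/eqP|/eqP].
Qed.

(** * The equivalence of the two problems *)

Lemma generic_setT k : generic [set: freeGroup 'I_k].
Proof.
rewrite /generic (_ : (fun n => _) = (fun=> 1%R)); first exact: cvg_cst.
apply/funext => n; rewrite setTI divff // pnatr_eq0 -lt0n.
by apply: (@fg_ball_card_ge k n [:: 1%g]) => // w; rewrite inE => /eqP->.
Qed.

Theorem theorem2 (G : groupType) (k : nat) (x : 'I_k -> G) :
  generating x ->
  recursively_presented G ->
  amenable G ->
  (solvable_word_problem x <-> solvable_generic_EP G).
Proof.
move=> gx _ _; split=> [wp_x|[k' [y [S [gy gS epS]]]]].
  by exists k, x, setT; split=> //; [apply: generic_setT | apply: solvable_EP_setT].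
(* The generating set that comes with [S] need not be [x], and it may have fewer than two
   elements. *)
apply: (solvable_word_problem_change x gy); have [k'_le1|k'_gt1] := leqP k' 1.
  exact: cyclic_word_problem.
exact: generic_EP_word_problem gS epS.
Qed.
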